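(* Let $T$ be a complete first-order theory, $G$ a $\emptyset$-definable group, and let $\mathcal E=\{\varphi_i(x,y,\bar z_i):i\in I,\ \bar z_i\}$ be a $\bigvee$-definable family defining an equivalence relation $E$ on $G$. Assume that $E_M$ is $G(M)$-invariant for every model $M$ of $T$. Then the existence of a $G(M)$-invariant, Borel probability measure on $S_{G/E_M}(M)$ does not depend on the choice of the model $M$.
   Context: A $\bigvee$-definable family is $\mathcal E=\{\varphi_i(x,y,\bar z_i):i\in I,\ \bar z_i\text{ from any model}\}$ with $\varphi_i$ formulas over $\emptyset$, each implying $x,y\in G$; $I$ is a directed set such that for $i<j$, for every $\bar z_i$ there is $\bar z_j$ such that $\varphi_j(x,y,\bar z_j)$ implies $\varphi_i(x,y,\bar z_i)$. For a model $M$, put $\mathcal E_M=\{\varphi_i(x,y,\bar b_i):i\in I,\ \bar b_i\subseteq M\}$ and $E_M=\bigcap\mathcal E_M$, interpreted in a monster model $M^*\succ M$ (sufficiently saturated and strongly homogeneous). $\mathcal E$ defines an equivalence relation if for every model $M$, $E_M$ is an ($M$-type-definable) equivalence relation on $G=G(M^* )$. $E_M$ is $G(M)$-invariant if $(a,b)\in E_M$ implies $(ga,gb)\in E_M$ for all $g\in G(M)$; then $G(M)$ acts on $S_{G/E_M}(M)$, the compact space of complete types over $M$ of elements of $G/E_M$ (orbits of $\mathrm{Aut}(M^*/M)$ on $G/E_M$, with the quotient topology from $S_G(M)$). *)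

(* Defs.v *)
From HB Require Import structures.
From mathcomp Require Import all_boot all_order all_algebra.
From mathcomp Require Import all_classical all_reals all_analysis.

Set Implicit Arguments.
Unset Strict Implicit.
Unset Printing Implicit Defensive.

Local Open Scope classical_set_scope.

(** * One-sorted first-order logic *)

Record language := Language {
  fsym : Type;
  far : fsym -> nat;
  rsym : Type;
  rar : rsym -> nat }.

(* [V] is the type of free variables.  A quantifier binds the variable [None]
   of [option V], so no variable is ever captured.  A formula in the variables
   [X] with parameters from [A] is a formula with free variables in [X + A]. *)
Inductive term (L : language) (V : Type) : Type :=
| Var of V
| App (f : fsym L) of ('I_(far f) -> term L V).
Arguments Var {L V}.
Arguments App {L V}.

Inductive formula (L : language) (V : Type) : Type :=
| Bot
| Eql of term L V & term L V
| Rel (r : rsym L) of ('I_(rar r) -> term L V)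
| Imp of formula L V & formula L V
| All of formula L (option V).
Arguments Bot {L V}.
Arguments Eql {L V}.
Arguments Rel {L V}.
Arguments Imp {L V}.
Arguments All {L V}.

Definition Neg L (V : Type) (phi : formula L V) : formula L V := Imp phi Bot.
Definition And L (V : Type) (phi psi : formula L V) : formula L V :=
  Neg (Imp phi (Neg psi)).

Fixpoint trename L (V W : Type) (r : V -> W) (t : term L V) : term L W :=
  match t with
  | Var v => Var (r v)
  | App f ts => App f (fun j => trename r (ts j))
  end.

Fixpoint frename L (V W : Type) (r : V -> W) (phi : formula L V) :
    formula L W :=
  match phi with
  | Bot => Bot
  | Eql t u => Eql (trename r t) (trename r u)
  | Rel p ts => Rel p (fun j => trename r (ts j))
  | Imp phi psi => Imp (frename r phi) (frename r psi)
  | All phi => All (frename (omap r) phi)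
  end.

Record structure (L : language) := Structure {
  carrier :> Type;
  carrier_inhabited : inhabited carrier;
  fint : forall f : fsym L, ('I_(far f) -> carrier) -> carrier;
  rint : forall r : rsym L, ('I_(rar r) -> carrier) -> Prop }.

Section satisfaction.
Variables (L : language) (M : structure L).

Fixpoint teval (V : Type) (v : V -> M) (t : term L V) : M :=
  match t with
  | Var x => v x
  | App f ts => fint (fun j => teval v (ts j))
  end.

Fixpoint sat (V : Type) (phi : formula L V) (v : V -> M) : Prop :=
  match phi with
  | Bot => False
  | Eql t u => teval v t = teval v u
  | Rel r ts => rint (fun j => teval v (ts j))
  | Imp phi psi => sat phi v -> sat psi v
  | All phi => forall x : M, sat phi (oapp v x)
  end.

End satisfaction.
Arguments sat {L} M {V} phi v.

Definition join (A B C : Type) (f : A -> C) (g : B -> C) (x : A + B) : C :=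
  match x with inl a => f a | inr b => g b end.

Definition theory (L : language) := set (formula L void).

Definition models L (M : structure L) (T : theory L) : Prop :=
  forall phi, T phi -> sat M phi (of_void M).

Record model L (T : theory L) := Model {
  mcarrier :> structure L;
  modelP : models mcarrier T }.

Definition entails L (T : theory L) (phi : formula L void) : Prop :=
  forall M : model T, sat M phi (of_void M).

Definition complete_theory L (T : theory L) : Prop :=
  inhabited (model T) /\
  (forall phi, entails T phi \/ entails T (Neg phi)).

Definition elementary L (M N : structure L) (f : M -> N) : Prop :=
  forall (V : Type) (phi : formula L V) (v : V -> M),
    sat M phi v <-> sat N phi (f \o v).

Definition automorphism L (M : structure L) (s : M -> M) : Prop :=
  [/\ bijective s,
      forall (f : fsym L) (a : 'I_(far f) -> M), s (fint a) = fint (s \o a) &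
      forall (r : rsym L) (a : 'I_(rar r) -> M), rint a <-> rint (s \o a)].

(* A set of formulas in the variables [X] with parameters from [A], the
   parameters being read in [M] through [h]. *)
Definition finitely_satisfiable L (M : structure L) (X A : Type) (h : A -> M)
    (p : set (formula L (X + A))) : Prop :=
  forall (k : nat) (F : 'I_k -> formula L (X + A)), (forall j, p (F j)) ->
  exists a : X -> M, forall j, sat M (F j) (join a h).

(** * Monster models *)

(* Saturation and strong homogeneity for the successor cardinal of [#|K|]:
   the parameter sets are those of cardinality at most [#|K|]. *)
Definition saturated L (M : structure L) (K : Type) : Prop :=
  forall (A : Type) (h : A -> M), ([set: A] #<= [set: K])%card ->
  forall (m : nat) (p : set (formula L ('I_m + A))),
    finitely_satisfiable h p ->
    exists a : 'I_m -> M, forall phi, p phi -> sat M phi (join a h).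

Definition strongly_homogeneous L (M : structure L) (K : Type) : Prop :=
  forall (A : Type) (f g : A -> M), ([set: A] #<= [set: K])%card ->
  (forall phi : formula L A, sat M phi f <-> sat M phi g) ->
  exists2 s : M -> M, automorphism s & forall x, s (f x) = g x.

Record monster L (M : structure L) := Monster {
  mstr :> structure L;
  memb : M -> mstr;
  memb_elementary : elementary memb;
  mcard : Type;
  mcard_large : ([set: nat + fsym L + rsym L + M] #<= [set: mcard])%card;
  monster_saturated : saturated mstr mcard;
  monster_homogeneous : strongly_homogeneous mstr mcard }.

Definition automorphism_over L (M : structure L) (Ms : monster M)
    (s : Ms -> Ms) : Prop :=
  automorphism s /\ forall m : M, s (memb Ms m) = memb Ms m.

(** * Definable groups and families of formulas *)

(* [G] defines the underlying set and [mul] the graph of the multiplication;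
   nothing is asked of [mul] outside that set. *)
Record group_in L n (G : formula L 'I_n)
    (mul : formula L ('I_n + 'I_n + 'I_n)) (M : structure L) : Prop := {
  group_op : forall a b : 'I_n -> M, sat M G a -> sat M G b ->
    exists c, [/\ sat M G c, sat M mul (join (join a b) c) &
                  forall c', sat M mul (join (join a b) c') -> c' = c];
  group_assoc : forall a b c ab bc d d' : 'I_n -> M,
    sat M G a -> sat M G b -> sat M G c ->
    sat M mul (join (join a b) ab) -> sat M mul (join (join ab c) d) ->
    sat M mul (join (join b c) bc) -> sat M mul (join (join a bc) d') ->
    d = d';
  group_unit_inv : exists2 e : 'I_n -> M, sat M G e &
    forall a, sat M G a ->
      [/\ sat M mul (join (join e a) a), sat M mul (join (join a e) a) &
          exists b, [/\ sat M G b, sat M mul (join (join a b) e) &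
                        sat M mul (join (join b a) e)]] }.

Record definable_group L (T : theory L) := DefinableGroup {
  gdim : nat;
  gdom : formula L 'I_gdim;
  gmul : formula L ('I_gdim + 'I_gdim + 'I_gdim);
  dgroupP : forall M : model T, group_in gdom gmul M }.
Arguments gdom {L T}.
Arguments gmul {L T}.

Lemma monster_models L (M : structure L) (T : theory L) (Ms : monster M) :
  models M T -> models Ms T.
Proof.
move=> MT psi /MT /(memb_elementary Ms).
by rewrite (_ : _ \o _ = of_void Ms)//; apply/funext; case.
Qed.

Section families.
Context L (T : theory L) (G : definable_group T) d (I : preorderType d).
Context (k : I -> nat).
Local Notation n := (gdim G).
Variable phi : forall i, formula L ('I_n + 'I_n + 'I_(k i)).

(* Requiring the refinement for [i <= j] adds nothing to the case [i < j]:
   for [i = j] it is trivial. *)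
Record vee_definable : Prop := {
  vee_inhabited : inhabited I;
  vee_directed : forall i j : I, exists l : I, (i <= l)%O /\ (j <= l)%O;
  vee_group : forall (M : model T) i (a b : 'I_n -> M) (z : 'I_(k i) -> M),
    sat M (phi i) (join (join a b) z) -> sat M (gdom G) a /\ sat M (gdom G) b;
  vee_refine : forall (M : model T) (i j : I) (z : 'I_(k i) -> M),
    (i <= j)%O -> exists z' : 'I_(k j) -> M, forall a b : 'I_n -> M,
      sat M (phi j) (join (join a b) z') ->
      sat M (phi i) (join (join a b) z) }.

Context (M : model T) (Ms : monster M).

Definition E_rel (a b : 'I_n -> Ms) : Prop :=
  [/\ sat Ms (gdom G) a, sat Ms (gdom G) b &
      forall i (z : 'I_(k i) -> M),
        sat Ms (phi i) (join (join a b) (memb Ms \o z))].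

Definition E_equivalence : Prop :=
  [/\ forall a, sat Ms (gdom G) a -> E_rel a a,
      forall a b, E_rel a b -> E_rel b a &
      forall a b c, E_rel a b -> E_rel b c -> E_rel a c].

Definition E_invariant : Prop :=
  forall (g : 'I_n -> M) (a b ga gb : 'I_n -> Ms), sat M (gdom G) g ->
    sat Ms (gmul G) (join (join (memb Ms \o g) a) ga) ->
    sat Ms (gmul G) (join (join (memb Ms \o g) b) gb) ->
    E_rel a b -> E_rel ga gb.

(* The element of [G/E_M] represented by [a]. *)
Definition E_class (a : 'I_n -> Ms) : set ('I_n -> Ms) := [set b | E_rel a b].

Definition aut_orbit (C : set ('I_n -> Ms)) : set (set ('I_n -> Ms)) :=
  [set D | exists2 s : Ms -> Ms, automorphism_over s &
                                 D = [set s \o a | a in C]].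

End families.

(** * Type spaces *)

Lemma teval_rename L (M : structure L) (V W : Type) (r : V -> W) (v : W -> M)
  (t : term L V) : teval v (trename r t) = teval (v \o r) t.
Proof. by elim: t => //= f ts IH; congr fint; apply/funext. Qed.

Lemma sat_rename L (M : structure L) (V : Type) (phi : formula L V) :
  forall (W : Type) (r : V -> W) (v : W -> M),
  sat M (frename r phi) v <-> sat M phi (v \o r).
Proof.
elim: phi => {V} [V|V t u|V p ts|V phi IH psi JH|V phi IH] W r v //=.
- by rewrite !teval_rename.
- by under eq_fun do rewrite teval_rename.
- by rewrite IH JH.
- have E x : oapp v x \o omap r = oapp (v \o r) x by apply/funext; case.
  by split=> H x; move: (H x); rewrite IH E.
Qed.

Section group_types.
Context L n (D : formula L 'I_n) (M : structure L).

(* Since [M] is a model, consistency with its elementary diagram is finite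
   satisfiability in [M]. *)
Record group_type := GroupType {
  gtype : set (formula L ('I_n + M));
  gtype_sat : finitely_satisfiable id gtype;
  gtype_complete : forall phi, gtype phi \/ gtype (Neg phi);
  gtype_group : gtype (frename inl D) }.

HB.instance Definition _ := gen_eqMixin group_type.
HB.instance Definition _ := gen_choiceMixin group_type.

Definition type_open : set (set group_type) :=
  [set U | forall p, U p -> exists2 phi, gtype p phi &
                            [set q : group_type | gtype q phi] `<=` U].

Lemma gtype_and (p : group_type) phi psi :
  gtype p (And phi psi) <-> gtype p phi /\ gtype p psi.
Proof.
have entail (F : 'I_2 -> formula L ('I_n + M)) chi :
    (forall j, gtype p (F j)) ->
    (forall v : _ -> M, (forall j, sat M (F j) v) -> sat M chi v) ->
    gtype p chi.
  move=> pF Fchi; have [//|pn] := gtype_complete p chi.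
  have [|a aP] := @gtype_sat p 3
    (fun j => if unlift ord0 j is Some j' then F j' else Neg chi).
    by move=> j; case: unliftP.
  move: (aP ord0); rewrite unlift_none => /=; case; apply: Fchi => j.
  by move: (aP (lift ord0 j)); rewrite liftK.
split=> [pa|[p1 p2]].
  split; apply: (entail (fun=> And phi psi)) => // v /(_ ord0) /= nn;
  by apply: contrapT => h; apply: nn => *; contradiction.
apply: (entail (fun j => if j == ord0 then phi else psi)).
  by move=> j; case: ifP.
by move=> v vP /= nn; exact: nn (vP ord0) (vP (lift ord0 ord0)).
Qed.

Lemma type_openT : type_open setT.
Proof. by move=> p _; exists (frename inl D); first exact: gtype_group. Qed.

Lemma type_openI : setI_closed type_open.
Proof.
move=> U V oU oV p [/oU [phi pphi sU] /oV [psi ppsi sV]].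
exists (And phi psi); first exact/gtype_and.
by move=> q /gtype_and [qphi qpsi]; split; [exact: sU|exact: sV].
Qed.

Lemma type_open_bigU (J : Type) (f : J -> set group_type) :
  (forall j, type_open (f j)) -> type_open (\bigcup_j f j).
Proof.
move=> of_ p [j _ /of_ [phi pphi s]]; exists phi => // q /s fq.
by exists j.
Qed.

HB.instance Definition _ :=
  isOpenTopological.Build group_type type_openT type_openI type_open_bigU.

End group_types.

Section hyper_types.
Context L (T : theory L) (G : definable_group T) d (I : preorderType d).
Context (k : I -> nat).
Local Notation n := (gdim G).
Variable phi : forall i, formula L ('I_n + 'I_n + 'I_(k i)).
Context (M : model T) (Ms : monster M).

(* [S_{G/E_M}(M)]: the orbits of [Aut(M^*/M)] on the set of [E_M]-classes. *)
Record hyper_type := HyperType {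
  htype : set (set ('I_n -> Ms));
  htypeP : exists2 a : 'I_n -> Ms, sat Ms (gdom G) a &
                                   htype = aut_orbit (E_class phi a) }.

HB.instance Definition _ := gen_eqMixin hyper_type.
HB.instance Definition _ := gen_choiceMixin hyper_type.

Definition hyper_type_of (a : 'I_n -> Ms) (Ga : sat Ms (gdom G) a) :
    hyper_type :=
  HyperType (ex_intro2 _ _ a Ga erefl).

Lemma hyper_type_inhabited : exists P : hyper_type, True.
Proof.
have [e Ge _] :=
  group_unit_inv (dgroupP G (Model (monster_models Ms (modelP M)))).
by exists (hyper_type_of Ge).
Qed.

HB.instance Definition _ :=
  isPointed.Build hyper_type (projT1 (cid hyper_type_inhabited)).

Definition realizes (a : 'I_n -> Ms) (p : group_type (gdom G) M) : Prop :=
  forall psi, gtype p psi -> sat Ms psi (join a (memb Ms)).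

Lemma card_le_inj (A B : Type) (f : A -> B) :
  injective f -> ([set: A] #<= [set: B])%card.
Proof.
move=> fI; apply: card_le_trans (subset_card_le (@subsetT _ (f @` setT))).
by rewrite (card_le_eqr (inj_card_eq (in2W fI))) card_lexx.
Qed.

Lemma memb_card : ([set: 'I_n + M] #<= [set: mcard Ms])%card.
Proof.
apply: card_le_trans (mcard_large Ms).
apply: (@card_le_inj _ _ (fun x : 'I_n + M =>
  match x with inl i => inl (inl (inl (val i))) | inr m => inr m end)).
by move=> [i|m] [j|m'] //= [E]; [rewrite (val_inj E)|rewrite E].
Qed.

Lemma realized (p : group_type (gdom G) M) : exists a, realizes a p.
Proof.
have cM : ([set: M] #<= [set: mcard Ms])%card.
  apply: card_le_trans (mcard_large Ms).
  by apply: (@card_le_inj _ _ inr) => x y [].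
apply: (monster_saturated cM) => j F /gtype_sat [a aP].
exists (memb Ms \o a) => l; have /(memb_elementary Ms) := aP l.
rewrite (_ : memb Ms \o _ = join (memb Ms \o a) (memb Ms))//.
by apply/funext; case.
Qed.

Lemma realizes_group a p : realizes a p -> sat Ms (gdom G) a.
Proof. by move=> /(_ _ (gtype_group p)) /sat_rename. Qed.

(* The projection [S_G(M) -> S_{G/E_M}(M)]; by [hyper_proj_realizes] it does
   not depend on the chosen realization. *)
Definition hyper_proj (p : group_type (gdom G) M) : hyper_type :=
  hyper_type_of (realizes_group (projT2 (cid (realized p)))).

Lemma teval_aut (s : Ms -> Ms) (V : Type) (v : V -> Ms) (t : term L V) :
  automorphism s -> teval (s \o v) t = s (teval v t).
Proof.
by case=> _ sf _; elim: t => //= f ts IH; rewrite sf; congr fint; apply/funext.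
Qed.

Lemma sat_aut (s : Ms -> Ms) (V : Type) (psi : formula L V) : automorphism s ->
  forall v : V -> Ms, sat Ms psi (s \o v) <-> sat Ms psi v.
Proof.
move=> sA; have [sb _ sr] := sA.
elim: psi => {V} [V|V t u|V p ts|V chi IH psi JH|V chi IH] v //=.
- by rewrite !teval_aut//; split=> [/(bij_inj sb)|->].
- have -> : (fun j => teval (s \o v) (ts j)) = s \o (fun j => teval v (ts j)).
    by apply/funext => j /=; exact: teval_aut.
  exact: iff_sym (sr _ _).
- by rewrite IH JH.
- have E x : oapp (s \o v) (s x) = s \o oapp v x by apply/funext; case.
  case: sb => s' _ s'K; split=> H x; first by rewrite -IH -E.
  by rewrite -(s'K x) E IH.
Qed.

Lemma automorphism_over_comp (s t : Ms -> Ms) :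
  automorphism_over s -> automorphism_over t -> automorphism_over (s \o t).
Proof.
move=> [[sb sf sr] sM] [[tb tf tr] tM]; split; last first.
  by move=> m /=; rewrite tM sM.
split; first exact: bij_comp.
- by move=> f a /=; rewrite tf sf.
- by move=> r a; rewrite tr sr.
Qed.

Lemma automorphism_over_inv (s : Ms -> Ms) : automorphism_over s ->
  exists t, [/\ automorphism_over t, cancel s t & cancel t s].
Proof.
move=> [[[t sK tK] sf sr] sM]; exists t; split=> //; split; last first.
  by move=> m; rewrite -{1}(sM m) sK.
have E A (a : A -> Ms) : s \o (t \o a) = a by apply/funext=> x /=; rewrite tK.
split; first by exists s.
- by move=> f a; apply: (can_inj sK); rewrite tK sf E.
- by move=> r a; rewrite (sr _ (t \o a)) E.
Qed.

Lemma E_rel_aut (s : Ms -> Ms) (a b : 'I_n -> Ms) : automorphism_over s ->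
  E_rel phi (s \o a) (s \o b) <-> E_rel phi a b.
Proof.
move=> [sA sM].
have E i (z : 'I_(k i) -> M) : join (join (s \o a) (s \o b)) (memb Ms \o z) =
    s \o join (join a b) (memb Ms \o z).
  by apply/funext=> -[[]|] //= j; rewrite sM.
by split=> -[Ga Gb H]; split=> [||i z]; try exact/(sat_aut _ sA);
  move: (H i z); rewrite E sat_aut.
Qed.

Lemma E_class_aut (s : Ms -> Ms) (a : 'I_n -> Ms) : automorphism_over s ->
  E_class phi (s \o a) = [set s \o b | b in E_class phi a].
Proof.
move=> sA; have [t [tA sK tK]] := automorphism_over_inv sA.
apply/seteqP; split=> b /=; last by case=> c ac <-; exact/E_rel_aut.
have Eb : s \o (t \o b) = b by apply/funext=> x /=; rewrite tK.
by rewrite -{1}Eb => /(E_rel_aut _ _ sA) ab; exists (t \o b).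
Qed.

Lemma aut_orbit_image (s : Ms -> Ms) (C : set ('I_n -> Ms)) :
  automorphism_over s -> aut_orbit [set s \o a | a in C] = aut_orbit C.
Proof.
move=> sA; have [t [tA sK tK]] := automorphism_over_inv sA.
apply/seteqP; split=> D [u uA ->].
  by exists (u \o s); [exact: automorphism_over_comp|rewrite image_comp].
exists (u \o t); first exact: automorphism_over_comp.
rewrite image_comp; apply: eq_imagel => a _ /=.
by apply/funext => x /=; rewrite sK.
Qed.

Lemma htype_inj (P Q : hyper_type) : htype P = htype Q -> P = Q.
Proof.
case: P Q => [P hP] [Q hQ] /= PQ; rewrite PQ in hP *.
by congr HyperType; exact: Prop_irrelevance.
Qed.

Lemma hyper_proj_realizes (p : group_type (gdom G) M) a
  (Ga : sat Ms (gdom G) a) : realizes a p -> hyper_proj p = hyper_type_of Ga.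
Proof.
rewrite /hyper_proj; case: cid => b /= bp ap; apply: htype_inj => /=.
have [|s sA sE] := monster_homogeneous
  (f := join a (memb Ms)) (g := join b (memb Ms)) memb_card.
  move=> psi; have [psip|psip] := gtype_complete p psi.
    by split=> _; [exact: bp|exact: ap].
  by split=> [/(ap _ psip)|/(bp _ psip)].
have sMs : automorphism_over s by split=> // m; exact: (sE (inr m)).
have <- : s \o a = b by apply/funext => j; exact: (sE (inl j)).
by rewrite E_class_aut// aut_orbit_image.
Qed.

Definition hyper_open : set (set hyper_type) :=
  [set U | open (hyper_proj @^-1` U)].

Lemma hyper_openT : hyper_open setT.
Proof. exact: openT. Qed.

Lemma hyper_openI : setI_closed hyper_open.
Proof. by move=> U V; exact: openI. Qed.

Lemma hyper_open_bigU (J : Type) (f : J -> set hyper_type) :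
  (forall j, hyper_open (f j)) -> hyper_open (\bigcup_j f j).
Proof.
move=> fo; rewrite /hyper_open /= preimage_bigcup.
by apply: bigcup_open => j _; exact: fo.
Qed.

HB.instance Definition _ :=
  isOpenTopological.Build hyper_type hyper_openT hyper_openI hyper_open_bigU.

End hyper_types.

(** * Invariant Borel measures *)

Notation borel X := (g_sigma_algebraType (@open X)).

Section invariant_measure.
Context L (T : theory L) (G : definable_group T) d (I : preorderType d).
Context (k : I -> nat).
Local Notation n := (gdim G).
Variable phi : forall i, formula L ('I_n + 'I_n + 'I_(k i)).
Context (M : model T) (Ms : monster M).

Definition left_translate (g : 'I_n -> M) (C : set ('I_n -> Ms)) :
    set ('I_n -> Ms) :=
  [set c | exists2 a, C a & sat Ms (gmul G) (join (join (memb Ms \o g) a) c)].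

(* [g] acts on classes by [C |-> gC], hence on orbits of classes by
   [P |-> {gC : C in P}], and on sets of orbits by taking images. *)
Definition translate (g : 'I_n -> M) (B : set (hyper_type phi Ms)) :
    set (hyper_type phi Ms) :=
  [set P | exists2 Q, B Q & htype P = [set left_translate g C | C in htype Q]].

Definition invariant_probability (R : realType)
    (mu : probability (borel (hyper_type phi Ms)) R) : Prop :=
  forall (g : 'I_n -> M) (B : set (borel (hyper_type phi Ms))),
    sat M (gdom G) g -> measurable B -> mu (translate g B) = mu B.

End invariant_measure.

(* Main.v *)
(** Existence of an invariant measure is a first-order property.  For [A]
    definable over [M] and a finite part [Phi] of [E_M], let [Phi[A]] be the set
    of the [y] with [Phi(a,y)] for some [a] in [A].  An invariant Borel
    probability on [S_{G/E_M}(M)] exists iff there is a finitely additive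
    probability [m] on the subsets of [G(M)] with [m(gA) <= m(Phi[A])] for all
    [g] in [G(M)], [A] and [Phi].

    From a measure [nu] to [m]: by compactness it suffices to treat finitely
    many of these inequalities.  Cut [G] into the finitely many pieces on which
    the relevant formulas are constant.  The images of the pieces in the type
    space are closed, so one can choose in a Borel way, for each point, a piece
    above it; [nu] then gives weights to the pieces, and the inequalities hold
    because the fibre over a point of the image of [A] lies in every [Phi[A]].

    From [m] to [nu]: the inner measure of an open set [U] is the supremum of
    the [m(A)] over the [A] whose image lies in [U].  By saturation it is
    countably subadditive on open sets and invariant (if the image of [gA] lies
    in [gU], so does that of some [Phi[gA]]), and Caratheodory's construction
    applies.

    Finally a finite set of the inequalities is solvable over [N] as soon as it
    is over [M]: solvability depends only on which combinations of the formulas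
    involved are realised, and [T] is complete. *)
From HB Require Import structures.
Require Import Defs.
From mathcomp Require Import all_boot all_order all_algebra.
From mathcomp Require Import all_classical all_reals all_analysis.

Set Implicit Arguments.
Unset Strict Implicit.
Unset Printing Implicit Defensive.

Import Order.TTheory GRing.Theory Num.Theory.
Import numFieldNormedType.Exports.

(** * Definable relations *)

Section definability.
Variable L : language.

(** One formula serves all structures [S] at once, which is what moves a property between models.
    The closure lemmas below produce formulas from predicates without handling bound variables. *)
Definition definable V (D : forall S : structure L, (V -> S) -> Prop) : Prop :=
  exists chi : formula L V, forall S v, sat S chi v <-> D S v.

Lemma definable_sat V (chi : formula L V) : definable (fun S v => sat S chi v).
Proof. by exists chi. Qed.

Lemma definable_ext V (D D' : forall S : structure L, (V -> S) -> Prop) :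
  (forall S v, D S v <-> D' S v) -> definable D -> definable D'.
Proof. by move=> DD' [chi chiP]; exists chi => S v; rewrite chiP. Qed.

Lemma definable_rename V W (r : V -> W)
    (D : forall S : structure L, (V -> S) -> Prop) :
  definable D -> definable (fun S (v : W -> S) => D S (v \o r)).
Proof.
by move=> [chi chiP]; exists (frename r chi) => S v; rewrite sat_rename chiP.
Qed.

Lemma definable_imp V (D D' : forall S : structure L, (V -> S) -> Prop) :
  definable D -> definable D' -> definable (fun S v => D S v -> D' S v).
Proof.
by move=> [p pP] [q qP]; exists (Imp p q) => S v /=; rewrite pP qP.
Qed.

Lemma definable_false V :
  definable (fun (S : structure L) (v : V -> S) => False).
Proof. by exists Bot. Qed.

Lemma definable_not V (D : forall S : structure L, (V -> S) -> Prop) :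
  definable D -> definable (fun S v => ~ D S v).
Proof. by move=> dD; apply: definable_imp dD (definable_false _). Qed.

Lemma definable_and V (D D' : forall S : structure L, (V -> S) -> Prop) :
  definable D -> definable D' -> definable (fun S v => D S v /\ D' S v).
Proof.
move=> dD /definable_not dD'.
apply: definable_ext (definable_not (definable_imp dD dD')) => S v.
by split=> [/not_implyP [? /contrapT]|[? ?] h]; [|exact: h].
Qed.

Lemma definable_forall_in V (J : eqType) (s : seq J)
    (D : J -> forall S : structure L, (V -> S) -> Prop) :
  (forall j, definable (D j)) ->
  definable (fun S v => forall j, j \in s -> D j S v).
Proof.
move=> dD; elim: s => [|j s IH].
  apply: definable_ext (definable_not (definable_false V)) => S v.
  by split=> [_ j|_ []//]; rewrite in_nil.
apply: definable_ext (definable_and (dD j) IH) => S v; split.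
  by move=> [Dj Ds] i; rewrite inE => /predU1P [->//|]; exact: Ds.
by move=> H; split=> [|i si]; apply: H; rewrite inE ?eqxx// si orbT.
Qed.

Lemma definable_forall_fin V (J : finType)
    (D : J -> forall S : structure L, (V -> S) -> Prop) :
  (forall j, definable (D j)) -> definable (fun S v => forall j, D j S v).
Proof.
move=> /(definable_forall_in (enum J)); apply: definable_ext => S v.
by split=> H j; [apply: H; rewrite mem_enum|move=> _; exact: H].
Qed.

Lemma definable_forall V (D : forall S : structure L, (option V -> S) -> Prop) :
  definable D -> definable (fun S v => forall x, D S (oapp v x)).
Proof.
by move=> [chi chiP]; exists (All chi) => S v; split=> /= H x;
  [apply/chiP|apply/chiP].
Qed.

Lemma definable_forall_tuple V n
    (D : forall S : structure L, ('I_n + V -> S) -> Prop) :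
  definable D -> definable (fun S v => forall a, D S (join a v)).
Proof.
elim: n D => [|n IH] D dD.
  have dD' := definable_rename
    (fun i : 'I_0 + V => match i with inl i => match notF (ltn_ord i) with end
                                    | inr v => v end) dD.
  apply: definable_ext dD' => S v; split => [H a|H].
    by move: H; congr D; apply/funext => -[[]|].
  have a : 'I_0 -> S by case.
  by move: (H a); congr D; apply/funext => -[[]|].
(* Coordinate 0 becomes the variable [None] bound by the new quantifier; the others form the tuple
   of the induction hypothesis. *)
pose r (i : 'I_n.+1 + V) : option ('I_n + V) := match i with
  | inl i => omap inl (unlift ord0 i) | inr v => Some (inr v) end.
have := IH _ (definable_forall (definable_rename r dD)).
apply: definable_ext => S v; split=> H a; last first.
  move=> x; set f := (X in D S X).
  suff -> : f = join (f \o inl) v by exact: H.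
  by apply/funext => -[].
have {H} := H (a \o lift ord0) (a ord0); congr D; apply/funext => -[i|] //=.
by case: unliftP => [j|] ->.
Qed.

Lemma definable_exists_tuple V n
    (D : forall S : structure L, ('I_n + V -> S) -> Prop) :
  definable D -> definable (fun S v => exists a, D S (join a v)).
Proof.
move=> /definable_not /definable_forall_tuple /definable_not.
apply: definable_ext => S v; split=> [/existsNP [a /contrapT]|[a Da] H].
  by exists a.
exact: H Da.
Qed.

Lemma elementary_definable (M N : structure L) (f : M -> N) V
    (D : forall S : structure L, (V -> S) -> Prop) (v : V -> M) :
  elementary f -> definable D -> D M v <-> D N (f \o v).
Proof. by move=> fE [chi chiP]; rewrite -!chiP; exact: fE. Qed.

(** * Finite supports of terms and formulas *)

Lemma term_finite_support V (t : term L V) :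
  exists (A : finType) (r : A -> V) (t' : term L A), t = trename r t'.
Proof.
elim: t => [x|f ts IH]; first by exists unit, (fun=> x), (Var tt).
pose A j := projT1 (cid (IH j)).
have g j : {rt : (A j -> V) * term L (A j) | ts j = trename rt.1 rt.2}.
  apply: cid; case: (projT2 (cid (IH j))) => r [t' E]; by exists (r, t').
exists {j : 'I_(far f) & A j}, (fun x => (sval (g (tag x))).1 (tagged x)).
exists (App f (fun j => trename (Tagged A) (sval (g j)).2)) => /=.
congr App; apply/funext => j; rewrite [LHS](svalP (g j)).
by elim: (sval (g j)).2 => //= h us JH; congr App; apply/funext.
Qed.

Lemma trename_comp V W X (r : V -> W) (q : W -> X) (t : term L V) :
  trename q (trename r t) = trename (q \o r) t.
Proof. by elim: t => //= f ts IH; congr App; apply/funext. Qed.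

Lemma frename_comp V (chi : formula L V) : forall W X (r : V -> W) (q : W -> X),
  frename q (frename r chi) = frename (q \o r) chi.
Proof.
elim: chi => {V} [V|V t u|V p ts|V p IHp q IHq|V p IH] W X f h //=.
- by rewrite !trename_comp.
- by congr Rel; apply/funext => j; exact: trename_comp.
- by rewrite IHp IHq.
- by rewrite IH; congr (All (frename _ p)); apply/funext; case.
Qed.

(** Supports of subformulas are combined by disjoint sums, so no decidable equality on [V] is
    needed; in return [r] need not be injective. *)
Lemma formula_finite_support V (chi : formula L V) :
  exists (A : finType) (r : A -> V) (chi' : formula L A), chi = frename r chi'.
Proof.
elim: chi => {V} [V|V t u|V p ts|V p IHp q IHq|V p IH].
- by exists void, (of_void V), Bot.
- have [A [r [t' ->]]] := term_finite_support t.
  have [B [q [u' ->]]] := term_finite_support u.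
  exists (A + B)%type, (join r q), (Eql (trename inl t') (trename inr u')).
  by rewrite /= !trename_comp.
- have A j := cid (term_finite_support (ts j)).
  have r j := cid (projT2 (A j)).
  have t j := cid (projT2 (r j)).
  exists {j : 'I_(rar p) & projT1 (A j)}.
  exists (fun x => projT1 (r (tag x)) (tagged x)).
  exists (Rel p (fun j => trename (Tagged (fun j => projT1 (A j)))
                                  (projT1 (t j)))) => /=.
  congr Rel; apply/funext => j; rewrite trename_comp.
  exact: (projT2 (t j)).
- have [A [r [p' ->]]] := IHp.
  have [B [s [q' ->]]] := IHq.
  exists (A + B)%type, (join r s), (Imp (frename inl p') (frename inr q')).
  by rewrite /= !frename_comp.
- have [A [r [p' ->]]] := IH.
  (* Names sent to [None] stand for the bound variable: [B] keeps the others, and [h] sends the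
     discarded ones back to [None]. *)
  pose B : finType := {x : A | isSome (r x)}.
  have rB (x : B) : exists v, r (val x) = Some v.
    by case: x => x /=; case: (r x) => [v|//] _; exists v.
  pose q (x : B) := projT1 (cid (rB x)).
  pose h (x : A) : option B := insub x.
  exists B, q, (All (frename h p')); rewrite /= frename_comp.
  congr (All (frename _ p')); apply/funext => x; rewrite /= /h.
  case: insubP => [y _ <-|]; last by case: (r x).
  exact: (projT2 (cid (rB y))).
Qed.

Lemma definable_exists_fin V (A : finType)
    (D : forall S : structure L, (A + V -> S) -> Prop) :
  definable D -> definable (fun S v => exists a, D S (join a v)).
Proof.
pose r (x : A + V) : 'I_#|A| + V :=
  match x with inl a => inl (enum_rank a) | inr v => inr v end.
move=> /(definable_rename r) /definable_exists_tuple.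
apply: definable_ext => S v; split=> [] [a Da].
  exists (a \o enum_rank); move: Da; congr D; by apply/funext; case.
exists (a \o enum_val); move: Da; congr D; apply/funext; case=> //= x.
by rewrite enum_rankK.
Qed.

End definability.

(* Only the finitely many values of [v] used by [chi] matter; the equalities
   between them are made part of the sentence, so that the witnesses found in
   [M] extend to all of [V]. *)
Lemma transfer L (T : theory L) (M N : model T) V (chi : formula L V)
    (v : V -> N) :
  complete_theory T -> sat N chi v -> exists v' : V -> M, sat M chi v'.
Proof.
move=> [_ Tc] Nchi; have [A [r [p E]]] := formula_finite_support chi.
have dE : definable (fun (S : structure L) (v : void -> S) =>
    exists a : A -> S,
      (forall ij : A * A, r ij.1 = r ij.2 -> a ij.1 = a ij.2) /\ sat S p a).
  pose D (S : structure L) (v : A + void -> S) :=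
    (forall ij : A * A, r ij.1 = r ij.2 -> v (inl ij.1) = v (inl ij.2)) /\
    sat S p (v \o inl).
  suff : definable D.
    by move=> /definable_exists_fin; apply: definable_ext => S w.
  apply: definable_and; last exact: (definable_rename inl (definable_sat p)).
  apply: definable_forall_fin => ij.
  have [e|e] := pselect (r ij.1 = r ij.2).
    exists (Eql (Var (inl ij.1)) (Var (inl ij.2))) => S w /=.
    by split=> [//|]; exact.
  by exists (Imp Bot Bot) => S w /=; split=> // _ /e.
have [s sP] := dE.
have Ns : sat N s (of_void N).
  apply/sP; exists (v \o r); split=> [ij /= ->//|].
  by apply/sat_rename; rewrite -E.
have [Ts|/(_ N) /= //] := Tc s.
have /sP [a [aP Ma]] := Ts M.
have [x0] := carrier_inhabited M.
exists (fun x => if pselect (exists i, r i = x) is left h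
                 then a (projT1 (cid h)) else x0).
rewrite E; apply/sat_rename; move: Ma; congr sat; apply/funext => i /=.
case: pselect => [h|[]]; last by exists i.
by apply: (aP (i, _)) => /=; case: cid => j /= ->.
Qed.

(** * Finitely additive probabilities *)

Section finite_families.
Local Open Scope classical_set_scope.

(* Finite lists, without decidable equality on [J]. *)
Definition fam (J : Type) := {r : nat & 'I_r -> J}.

Definition fam_in J (l : fam J) : set J := range (projT2 l).

Lemma fam_of_finType J (A : finType) (f : A -> J) :
  exists l : fam J, fam_in l = range f.
Proof.
exists (existT _ #|A| (f \o enum_val)); rewrite /fam_in /=.
apply/seteqP; split=> [j [i _ <-]|j [a _ <-]]; first by exists (enum_val i).
by exists (enum_rank a) => //=; rewrite enum_rankK.
Qed.

Lemma fam_nil J : exists l : fam J, fam_in l = set0.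
Proof.
have [l El] := fam_of_finType (of_void J).
by exists l; rewrite El; apply/seteqP; split=> // j [].
Qed.

Lemma fam_one J (j : J) : exists l : fam J, fam_in l = [set j].
Proof.
have [l El] := fam_of_finType (fun _ : unit => j).
by exists l; rewrite El; apply/seteqP; split=> [_ [_ _ <-]//|_ ->]; exists tt.
Qed.

Lemma fam_bigcup J (A : finType) (l : A -> fam J) :
  exists l' : fam J, fam_in l' = \bigcup_a fam_in (l a).
Proof.
have [l' El'] := fam_of_finType
  (fun x : {a : A & 'I_(projT1 (l a))} => projT2 (l (tag x)) (tagged x)).
exists l'; rewrite El'; apply/seteqP; split=> [_ [[a i] _ <-]|j [a _ [i _ <-]]].
  by exists a => //; exists i.
by exists (Tagged (fun a => 'I_(projT1 (l a))) i).
Qed.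

End finite_families.

Section mean.
Variable R : realType.
Local Open Scope ring_scope.
Local Open Scope classical_set_scope.

(** All subsets are measured, so that a mean can be carried along an arbitrary map
    ([mean_image]). *)
Record mean X (m : set X -> R) : Prop := Mean {
  mean_ge0 : forall A, 0 <= m A;
  meanT : m setT = 1;
  meanU : forall A B, A `&` B = set0 -> m (A `|` B) = m A + m B }.

Variables (X : Type) (m : set X -> R).
Hypothesis mP : mean m.

Lemma mean0 : m set0 = 0.
Proof.
have := meanU mP (set0I set0); rewrite setU0 => /eqP.
by rewrite -subr_eq0 opprD addrA subrr sub0r oppr_eq0 => /eqP.
Qed.

Lemma mean_le A B : A `<=` B -> m A <= m B.
Proof.
move=> AB; rewrite -(setDUK AB) (meanU mP) ?setDIK// lerDl.
exact: mean_ge0.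
Qed.

Lemma mean_le1 A : m A <= 1.
Proof. by rewrite -(meanT mP); exact: mean_le. Qed.

Lemma mean_subU A B : m (A `|` B) <= m A + m B.
Proof.
have -> : A `|` B = A `|` (B `\` A) by rewrite setDE setUIr setUCr setIT.
rewrite (meanU mP) ?setDIK// lerD2l; apply: mean_le; exact: subDsetl.
Qed.

Lemma mean_sub_bigcup n (F : nat -> set X) A :
  A `<=` \bigcup_(i in `I_n) F i -> m A <= \sum_(i < n) m (F i).
Proof.
elim: n A => [|n IH] A.
  by rewrite II0 bigcup_set0 big_ord0 subset0 => ->; rewrite mean0.
rewrite big_ord_recr/= => AF.
have {AF} : A `<=` (A `&` \bigcup_(i in `I_n) F i) `|` F n.
  move=> x Ax; have [i /= ] := AF x Ax.
  rewrite ltnS leq_eqVlt => /predU1P[->|ilt] Fx; [by right|left].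
  by split=> //; exists i.
move/mean_le/le_trans; apply; apply: le_trans (mean_subU _ _) _.
by rewrite lerD2r; apply: IH; exact: subIsetr.
Qed.

Lemma mean_image Y (f : X -> Y) : mean (fun B => m (f @^-1` B)).
Proof.
split=> [A||A B AB]; first exact: mean_ge0.
  by rewrite preimage_setT meanT.
by rewrite preimage_setU (meanU mP)// -preimage_setI AB preimage_set0.
Qed.

End mean.

(** * Limits of means along an ultrafilter *)

Section mean_limit.
Variable R : realType.
Local Open Scope ring_scope.
Local Open Scope classical_set_scope.

Lemma fmap_ultra S Y (f : S -> Y) (U : set_system S) :
  UltraFilter U -> UltraFilter (f x @[x --> U]).
Proof.
move=> UU; split=> [|G GF UG]; apply/seteqP || exact: fmap_proper_filter.
split=> // A GA; have [//|UnA] := in_ultra_setVsetC (f @^-1` A) UU.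
have : G (A `&` ~` A) by apply: filterI GA _; exact: UG.
by rewrite setICr => /filter_not_empty.
Qed.

(** All values lie in the compact interval [[0, 1]], so the solutions for finite lists converge
    pointwise along an ultrafilter, and every requirement on [m] passes to the limit. *)
Lemma mean_limit X (G : set X) C (lhs rhs : C -> set X) :
  (forall l : fam C, exists m : set X -> R,
     [/\ mean m, m G = 1 &
         forall c, fam_in l c -> m (lhs c) <= m (rhs c)]) ->
  exists m : set X -> R,
    [/\ mean m, m G = 1 & forall c, m (lhs c) <= m (rhs c)].
Proof.
move=> /choice[w wP].
(* The sets containing all lists beyond some [l0]: each single inequality holds on a member of
   [F]. *)
pose F : set_system (fam C) := [set S | exists l0, forall l,
  fam_in l0 `<=` fam_in l -> S l].
have FF : ProperFilter F.
  split; first by move=> [l /(_ l)]; exact.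
  split.
  - by have [l _] := fam_nil C; exists l.
  - move=> P Q [l Pl] [l' Ql'].
    have [k E] := fam_bigcup (fun b : bool => if b then l else l').
    exists k => j; rewrite E => jP; split.
      by apply: Pl => c lc; apply: jP; exists true.
    by apply: Ql' => c lc; apply: jP; exists false.
  - by move=> P Q PQ [l Pl]; exists l => j /Pl /PQ.
have [U [UU FU]] := ultraFilterLemma FF.
have Ucvg (B : set X) : cvg (w l B @[l --> U]).
  have := @segment_compact R 0 1; rewrite compact_ultra => cpt.
  have UB : U [set l | `[0, 1] (w l B)].
    apply: filterS (filterT : U setT) => l _ /=; have [wl _ _] := wP l.
    by rewrite in_itv /= mean_ge0//= mean_le1.
  have [y [_ yP]] := cpt _ (fmap_ultra (fun l => w l B) UU) UB.
  by apply/cvg_ex; exists y.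
exists (fun B => lim (w l B @[l --> U])); split; first split.
- move=> A; apply: limr_ge => //; apply: nearW => l.
  by have [wl _ _] := wP l; exact: mean_ge0.
- rewrite (_ : (fun l => w l setT) = cst 1) ?lim_cst//.
  by apply/funext => l; have [wl _ _] := wP l; rewrite meanT.
- move=> A B AB; rewrite -limD//; congr lim; congr (_ @ U).
  by apply/funext => l; have [wl _ _] := wP l; rewrite (meanU wl).
- rewrite (_ : (fun l => w l G) = cst 1) ?lim_cst//.
  by apply/funext => l; have [_ wl _] := wP l.
- move=> c; have UC : U [set l | w l (lhs c) <= w l (rhs c)].
    have [l El] := fam_one c; apply: FU; exists l => j; rewrite El => cj.
    by have [_ _] := wP j; apply; exact: cj.
  rewrite -subr_ge0 -limB//; apply: limr_ge; first exact: is_cvgB.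
  by apply: filterS UC => l /=; rewrite subr_ge0.
Qed.

End mean_limit.

(** * The inequalities m(gA) <= m(Phi[A]) *)

Lemma comp_join (A B C D : Type) (h : C -> D) (f : A -> C) (g : B -> C) :
  h \o join f g = join (h \o f) (h \o g).
Proof. by apply/funext; case. Qed.

Lemma definable_sat_rename L V W (chi : formula L V) (r : V -> W) :
  definable (fun S (v : W -> S) => sat S chi (v \o r)).
Proof. exact: (definable_rename r (definable_sat chi)). Qed.

Lemma definable_signs L V (J : finType) (F : J -> formula L V)
    (s : J -> bool) :
  definable (fun S (v : V -> S) => forall j, sat S (F j) v <-> s j).
Proof.
apply: definable_forall_fin => j; case: (s j).
  by apply: definable_ext (definable_sat (F j)) => S w; split=> [|->].
apply: definable_ext (definable_not (definable_sat (F j))) => S w.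
by split=> [?|->].
Qed.

Lemma definable_pattern L V n (J : finType)
    (F : J -> formula L ('I_n + V)) (s : {ffun J -> bool}) :
  definable (fun S (v : V -> S) => exists a : 'I_n -> S,
    forall j, sat S (F j) (join a v) <-> s j).
Proof.
exact: definable_exists_tuple (definable_signs F s).
Qed.

Lemma pattern_transfer L (T : theory L) (M N : model T) V n (J : finType)
    (F : J -> formula L ('I_n + V)) (v : V -> N) :
  complete_theory T -> exists (v' : V -> M) (h : ('I_n -> M) -> 'I_n -> N),
    forall x j, sat N (F j) (join (h x) v) <-> sat M (F j) (join x v').
Proof.
move=> Tc.
pose real (S : structure L) (w : V -> S) (s : {ffun J -> bool}) :=
  exists a : 'I_n -> S, forall j, sat S (F j) (join a w) <-> s j.
(* Since [real N v s] is a fixed truth value, each disjunction is either trivial or a negated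
   pattern. Only one direction is asked: to build [h], patterns realised in [M] must be realised in
   [N]. *)
have [chi chiP] : definable (fun (S : structure L) (w : V -> S) =>
    forall s, real N v s \/ ~ real S w s).
  apply: definable_forall_fin => s.
  have [rs|nrs] := pselect (real N v s).
    apply: definable_ext (definable_not (definable_false L V)) => S w.
    by split=> [_|_ []//]; left.
  apply: definable_ext (definable_not (definable_pattern F s)) => S w.
  by split=> [?|[]]; [right|move=> /nrs|].
have [|v' /chiP Mv'] := @transfer L T M N V chi v Tc.
  by apply/chiP => s; exact: lem.
exists v'; suff /choice [h hP] : forall x : 'I_n -> M, exists y : 'I_n -> N,
  forall j, sat N (F j) (join y v) <-> sat M (F j) (join x v') by exists h.
move=> x; pose s := [ffun j => `[< sat M (F j) (join x v') >]].
have [[y yP]|[]] := Mv' s.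
  by exists y => j; rewrite yP ffunE; split=> /asboolP.
by exists x => j; rewrite ffunE; split=> /asboolP.
Qed.

Section conditions.
Context L (T : theory L) (G : definable_group T) (I : Type).
Context (k : I -> nat).
Local Notation n := (gdim G).
Variable phi : forall i, formula L ('I_n + 'I_n + 'I_(k i)).
Local Open Scope classical_set_scope.

(** Parameters are read through [v], so that one formula gives a set both in [M] ([v := id]) and in
    the monster ([v := memb Ms]). *)
Definition dset V (S : structure L) (v : V -> S) (A : formula L ('I_n + V)) :
    set ('I_n -> S) :=
  [set a | sat S (gdom G) a /\ sat S A (join a v)].

(* Empty when [g] is not in [G], so that the inequalities below need no
   hypothesis on [g]. *)
Definition tset V (S : structure L) (v : V -> S) (g : 'I_n -> V)
    (A : formula L ('I_n + V)) : set ('I_n -> S) :=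
  [set y | sat S (gdom G) (v \o g) /\
     exists a, dset v A a /\ sat S (gmul G) (join (join (v \o g) a) y)].

(** This is [Phi[A]], where [Phi] lists finitely many instances of the family. *)
Definition nset V (S : structure L) (v : V -> S)
    (Phi : fam {i : I & 'I_(k i) -> V}) (A : formula L ('I_n + V)) :
    set ('I_n -> S) :=
  [set y | sat S (gdom G) y /\
     exists a, dset v A a /\ forall e, fam_in Phi e ->
       sat S (phi (tag e)) (join (join a y) (v \o tagged e))].

Lemma tset_formula V (g : 'I_n -> V) (A : formula L ('I_n + V)) :
  exists F : formula L ('I_n + V),
    forall (S : structure L) (v : V -> S) (y : 'I_n -> S),
    sat S F (join y v) <-> tset v g A y.
Proof.
pose r := join (join (inr \o inr \o g) inl) (inr \o inl) :
  'I_n + 'I_n + 'I_n -> 'I_n + ('I_n + V).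
have [F FP] := definable_and (definable_sat_rename (gdom G) (inr \o g))
  (definable_exists_tuple (definable_and
    (definable_and (definable_sat_rename (gdom G) inl)
       (definable_sat_rename A (join inl (inr \o inr))))
    (definable_sat_rename (gmul G) r))).
exists F => S v y; rewrite FP; apply: and_iff_compat_l.
by split=> -[a H]; exists a; move: H; rewrite !comp_join.
Qed.

Lemma nset_formula V (Phi : fam {i : I & 'I_(k i) -> V})
    (A : formula L ('I_n + V)) :
  exists F : formula L ('I_n + V),
    forall (S : structure L) (v : V -> S) (y : 'I_n -> S),
    sat S F (join y v) <-> nset v Phi A y.
Proof.
pose e j := projT2 Phi j.
pose r j := join (join inl (inr \o inl)) (inr \o inr \o tagged (e j)) :
  'I_n + 'I_n + 'I_(k (tag (e j))) -> 'I_n + ('I_n + V).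
have [F FP] := definable_and (definable_sat_rename (gdom G) inl)
  (definable_exists_tuple (definable_and
    (definable_and (definable_sat_rename (gdom G) inl)
       (definable_sat_rename A (join inl (inr \o inr))))
    (definable_forall_fin (fun j =>
       definable_sat_rename (phi (tag (e j))) (r j))))).
exists F => S v y; rewrite FP; apply: and_iff_compat_l.
split=> -[a [dA aP]]; exists a; split.
- by move: dA; rewrite comp_join.
- by move=> _ [j _ <-]; have := aP j; rewrite !comp_join.
- by move: dA; rewrite /dset comp_join.
- by move=> j; rewrite !comp_join; apply: aP; exists j.
Qed.

(* [Cond g A Phi] stands for the inequality [m(gA) <= m(Phi[A])]. *)
Record cond V := Cond {
  cond_elt : 'I_n -> V;
  cond_set : formula L ('I_n + V);
  cond_nbhd : fam {i : I & 'I_(k i) -> V} }.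

Definition lhs V (S : structure L) (v : V -> S) (c : cond V) :=
  tset v (cond_elt c) (cond_set c).

Definition rhs V (S : structure L) (v : V -> S) (c : cond V) :=
  nset v (cond_nbhd c) (cond_set c).

Definition cond_map V W (r : V -> W) (c : cond V) : cond W :=
  Cond (r \o cond_elt c) (frename (join inl (inr \o r)) (cond_set c))
    (existT (fun m => 'I_m -> {i : I & 'I_(k i) -> W}) (projT1 (cond_nbhd c))
      (fun j => let e := projT2 (cond_nbhd c) j in
                Tagged (fun i => 'I_(k i) -> W) (r \o tagged e))).

Lemma dset_map V W (r : V -> W) (S : structure L) (v : W -> S) A :
  dset v (frename (join inl (inr \o r)) A) = dset (v \o r) A.
Proof.
apply/seteqP; split=> a [Ga Aa]; split=> //;
  by move: Aa; rewrite ?sat_rename comp_join.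
Qed.

Lemma lhs_map V W (r : V -> W) (S : structure L) (v : W -> S) (c : cond V) :
  lhs v (cond_map r c) = lhs (v \o r) c.
Proof. by rewrite /lhs /tset /= dset_map. Qed.

Lemma rhs_map V W (r : V -> W) (S : structure L) (v : W -> S) (c : cond V) :
  rhs v (cond_map r c) = rhs (v \o r) c.
Proof.
rewrite /rhs /nset /= dset_map; apply/seteqP; split=> y [Gy [a [Aa aP]]];
  split=> //; exists a; split=> // e [j _ <-].
  by apply: (aP (Tagged (fun i => 'I_(k i) -> W) (r \o _))); exists j.
by apply: aP; exists j.
Qed.

(** * Transfer of the inequalities between models *)

Section transfer_conditions.
Variable R : realType.
Local Open Scope ring_scope.

Definition conds_satisfied (M : structure L) (C : set (cond M)) : Prop :=
  exists m : set ('I_n -> M) -> R,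
    [/\ mean m, m [set a | sat M (gdom G) a] = 1 &
        forall c, C c -> m (lhs id c) <= m (rhs id c)].

Lemma conds_transfer (M N : model T) : complete_theory T ->
  (forall l : fam (cond M), conds_satisfied (fam_in l)) ->
  forall l : fam (cond N), conds_satisfied (fam_in l).
Proof.
move=> Tc HM l.
have /choice [FL FLP] := fun c : cond N =>
  tset_formula (cond_elt c) (cond_set c).
have /choice [FR FRP] := fun c : cond N =>
  nset_formula (cond_nbhd c) (cond_set c).
(* Both sides of each inequality, tagged [true] (left) and [false] (right), and [G] itself, whose
   mass must remain 1. *)
pose J : finType := ('I_(projT1 l) * bool + unit)%type.
pose F (j : J) := match j with
  | inl (j, b) => if b then FL (projT2 l j) else FR (projT2 l j)
  | inr _ => frename inl (gdom G) end.
have [v' [h hP]] := pattern_transfer M F id Tc.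
(* The inequalities with their parameters moved into [M]; a solution of these is carried back to [N]
   along [h], which preserves membership in all the sets involved. *)
pose l' : fam (cond M) := existT _ _ (fun j => cond_map v' (projT2 l j)).
have [m [mP m1 mC]] := HM l'.
exists (fun B => m (h @^-1` B)); split; first exact: mean_image.
  rewrite -m1; congr m; apply/seteqP; split=> x /=;
  by have := hP x (inr tt); rewrite /= !sat_rename => ->.
move=> c [j _ <-]; set c' := projT2 l j.
have hL : h @^-1` lhs id c' = lhs id (cond_map v' c').
  by rewrite lhs_map; apply/seteqP; split=> x;
    have := hP x (inl (j, true)); rewrite /= !FLP => E; rewrite /lhs/= E.
have hR : h @^-1` rhs id c' = rhs id (cond_map v' c').
  by rewrite rhs_map; apply/seteqP; split=> x;
    have := hP x (inl (j, false)); rewrite /= !FRP => E; rewrite /rhs/= E.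
by rewrite hL hR; apply: mC; exists j.
Qed.

End transfer_conditions.
End conditions.

Arguments dset {L T} G {V S} v A.
Arguments tset {L T} G {V S} v g A.

(** * The quotient type space *)

(** If [yx = e] and [xa = c], then [yc = (yx)a = a]. Multiplication being only a graph, this
    equivalence serves as the cancellation law. *)
Lemma group_inverse L n (D : formula L 'I_n) mul (S : structure L)
    (g : 'I_n -> S) : group_in D mul S -> sat S D g ->
  exists2 g', sat S D g' &
    forall a c, sat S D a -> sat S D c ->
      (sat S mul (join (join g a) c) <-> sat S mul (join (join g' c) a)).
Proof.
move=> gS Dg; have [e De eP] := group_unit_inv gS.
have cancel x y a c : sat S D x -> sat S D y -> sat S D a -> sat S D c ->
    sat S mul (join (join y x) e) -> sat S mul (join (join x a) c) ->
    sat S mul (join (join y c) a).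
  move=> Dx Dy Da Dc yx xa; have [ea _ _] := eP _ Da.
  have [b [Db yc _]] := group_op gS Dy Dc.
  by rewrite (group_assoc gS Dy Dx Da yx ea xa yc).
have [_ _ [g' [Dg' gg' g'g]]] := eP _ Dg.
by exists g' => // a c Da Dc; split; apply: cancel.
Qed.

Lemma sat_and L (S : structure L) V (p q : formula L V) (v : V -> S) :
  sat S (And p q) v <-> sat S p v /\ sat S q v.
Proof.
split=> [/= /not_implyP [? /contrapT]|[? ?] /= h]; first by [].
exact: h.
Qed.

Section hyper.
Context L (T : theory L) (G : definable_group T) d (I : preorderType d).
Context (k : I -> nat).
Local Notation n := (gdim G).
Variable phi : forall i, formula L ('I_n + 'I_n + 'I_(k i)).
Context (M : model T) (Ms : monster M).
Hypotheses (hE : E_equivalence phi Ms) (hinv : E_invariant phi Ms).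
Local Open Scope classical_set_scope.

Notation X := (hyper_type phi Ms).
Notation act g a c := (sat Ms (gmul G) (join (join (memb Ms \o g) a) c)).

Lemma monster_group : group_in (gdom G) (gmul G) Ms.
Proof. exact: (dgroupP G (Model (monster_models Ms (modelP M)))). Qed.

Lemma definable_memb V (D : forall S : structure L, (V -> S) -> Prop)
    (v : V -> M) : definable D -> D M v <-> D Ms (memb Ms \o v).
Proof. exact: (elementary_definable v (memb_elementary Ms)). Qed.

Lemma memb_group (g : 'I_n -> M) :
  sat M (gdom G) g <-> sat Ms (gdom G) (memb Ms \o g).
Proof. exact: memb_elementary. Qed.

(** The inverse is taken in [M]; the equivalence is a first-order property of [(g, g')], hence also
    holds in the monster. *)
Lemma memb_inverse (g : 'I_n -> M) : sat M (gdom G) g ->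
  exists2 g' : 'I_n -> M, sat M (gdom G) g' &
    forall a c, sat Ms (gdom G) a -> sat Ms (gdom G) c ->
      (act g a c <-> act g' c a).
Proof.
move=> Gg; have [g' Gg' gg'] := group_inverse (dgroupP G M) Gg.
exists g' => //.
(* The equivalence is written with [~] and [->] so that it is visibly a
   formula. *)
pose D (S : structure L) (w : 'I_n + 'I_n -> S) := forall a c : 'I_n -> S,
  sat S (gdom G) a -> sat S (gdom G) c ->
  ~ ((sat S (gmul G) (join (join (w \o inl) a) c) ->
      sat S (gmul G) (join (join (w \o inr) c) a)) ->
     ~ (sat S (gmul G) (join (join (w \o inr) c) a) ->
        sat S (gmul G) (join (join (w \o inl) a) c))).
have dD : definable D.
  pose W : Type := ('I_n + ('I_n + ('I_n + 'I_n)))%type.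
  pose c : 'I_n -> W := inl.
  pose a : 'I_n -> W := inr \o inl.
  pose x : 'I_n -> W := inr \o inr \o inl.
  pose y : 'I_n -> W := inr \o inr \o inr.
  have d1 := definable_sat_rename (gmul G) (join (join x a) c).
  have d2 := definable_sat_rename (gmul G) (join (join y c) a).
  have d3 := definable_not (definable_imp (definable_imp d1 d2)
    (definable_not (definable_imp d2 d1))).
  have d4 := definable_imp (definable_sat_rename (gdom G) a)
    (definable_imp (definable_sat_rename (gdom G) c) d3).
  have [chi chiP] := definable_forall_tuple (definable_forall_tuple d4).
  exists chi => S w; rewrite chiP /D.
  by split=> H a' c'; have := H a' c'; rewrite !comp_join.
have : D M (join g g').
  by move=> a c Ga Gc; have [h1 h2] := gg' _ _ Ga Gc; exact.
move/(definable_memb _ dD) => H a c Ga Gc.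
by have := H _ _ Ga Gc; rewrite !comp_join => /not_implyP [h1 /contrapT h2].
Qed.

(** * Points of the quotient through their representatives *)

Definition rep (a : 'I_n -> Ms) (P : X) : Prop :=
  exists Ga : sat Ms (gdom G) a, P = hyper_type_of phi Ga.

Lemma rep_group a P : rep a P -> sat Ms (gdom G) a.
Proof. by case. Qed.

Lemma rep_ex P : exists a, rep a P.
Proof.
by have [a Ga E] := htypeP P; exists a, Ga; apply: htype_inj.
Qed.

Lemma group_rep a : sat Ms (gdom G) a -> exists P, rep a P.
Proof. by move=> Ga; exists (hyper_type_of phi Ga), Ga. Qed.

Lemma rep_htype a P : rep a P -> htype P = aut_orbit (E_class phi a).
Proof. by case=> Ga ->. Qed.

Lemma htype_rep a P : sat Ms (gdom G) a ->
  htype P = aut_orbit (E_class phi a) -> rep a P.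
Proof. by move=> Ga E; exists Ga; exact: htype_inj. Qed.

Lemma rep_unique a P Q : rep a P -> rep a Q -> P = Q.
Proof. by move=> /rep_htype aP /rep_htype aQ; apply: htype_inj; rewrite aP. Qed.

Lemma rep_aut (s : Ms -> Ms) a P :
  automorphism_over s -> rep a P -> rep (s \o a) P.
Proof.
move=> sA aP; apply: htype_rep.
  by apply/(sat_aut _ (proj1 sA)); exact: rep_group aP.
by rewrite E_class_aut// aut_orbit_image//; exact: rep_htype.
Qed.

Lemma rep_E a b P : E_rel phi a b -> rep a P -> rep b P.
Proof.
have [_ sym trans] := hE.
move=> ab aP; apply: htype_rep; first by case: ab.
rewrite (rep_htype aP); congr aut_orbit; apply/seteqP; split=> c.
  exact/trans/sym.
exact: trans.
Qed.

Lemma automorphism_over_id : automorphism_over (id : Ms -> Ms).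
Proof. by split=> //; split=> //; exists id. Qed.

(** The class of [b] lies in the orbit of the class of [a], so it is the image of that class under
    some [s], and it contains [b]. *)
Lemma rep_conj a b P : rep a P -> rep b P ->
  exists2 s : Ms -> Ms, automorphism_over s & E_rel phi (s \o a) b.
Proof.
have [refl _ _] := hE.
move=> aP bP; have : aut_orbit (E_class phi a) (E_class phi b).
  rewrite -(rep_htype aP) (rep_htype bP); exists id.
    exact: automorphism_over_id.
  by rewrite (_ : (fun x => id \o x) = id) ?image_id//; apply/funext.
move=> [s sA E]; exists s => //.
have : E_class phi b b by exact/refl/rep_group/bP.
by rewrite E -E_class_aut.
Qed.

Definition im (A : formula L ('I_n + M)) : set X :=
  [set P | exists a, dset G (memb Ms) A a /\ rep a P].

Lemma dset_rep A a P U : im A `<=` U -> dset G (memb Ms) A a -> rep a P -> U P.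
Proof. by move=> AU Aa aP; apply: AU; exists a. Qed.

Lemma dset_aut (s : Ms -> Ms) A a : automorphism_over s ->
  dset G (memb Ms) A a -> dset G (memb Ms) A (s \o a).
Proof.
move=> sA [Ga Aa]; split; first exact/(sat_aut _ (proj1 sA)).
rewrite (_ : join _ _ = s \o join a (memb Ms)).
  exact/(sat_aut _ (proj1 sA)).
by rewrite comp_join; congr join; apply/funext => m /=; rewrite (proj2 sA).
Qed.

(** A representative in [A] can be moved by an automorphism over [M] to one related to [a]; it stays
    in [A], whose parameters are in [M]. *)
Lemma im_nset A Phi a P : rep a P -> im A P -> nset phi (memb Ms) Phi A a.
Proof.
move=> aP [b [Ab bP]]; have [s sA [Gb Ga sE]] := rep_conj bP aP.
split=> //; exists (s \o b); split; first exact: dset_aut.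
by move=> e _; exact: sE.
Qed.

(** * Compactness and the quotient topology *)

Lemma monster_compact W (h : W -> Ms) m (p : set (formula L ('I_m + W))) :
  ([set: W] #<= [set: mcard Ms])%card ->
  (forall a, exists2 psi, p psi & ~ sat Ms psi (join a h)) ->
  exists2 l : fam (formula L ('I_m + W)), fam_in l `<=` p &
    forall a, exists2 psi, fam_in l psi & ~ sat Ms psi (join a h).
Proof.
move=> cW H; apply: contrapT => nl.
have [|a aP] := monster_saturated cW (h := h) (p := p).
  move=> r F Fp; apply: contrapT => nF; apply: nl.
  exists (existT _ r F); first by move=> _ [j _ <-].
  move=> a; apply: contrapT => na; apply: nF; exists a => j.
  by apply: contrapT => nj; apply: na; exists (F j) => //; exists j.
by have [psi /aP] := H a.
Qed.

Lemma card_memb : ([set: M] #<= [set: mcard Ms])%card.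
Proof.
apply: card_le_trans (mcard_large Ms).
by apply: (@card_le_inj _ _ inr) => x y [].
Qed.

(** [monster_compact] for the negated formulas: covers have finite subcovers. *)
Lemma monster_cover (p : set (formula L ('I_n + M))) :
  (forall a, exists2 psi, p psi & sat Ms psi (join a (memb Ms))) ->
  exists2 l : fam (formula L ('I_n + M)), fam_in l `<=` p &
    forall a, exists2 psi, fam_in l psi & sat Ms psi (join a (memb Ms)).
Proof.
move=> H; have [|l lp lP] := @monster_compact _ (memb Ms) n
    [set Neg psi | psi in p] card_memb.
  by move=> a; have [psi ppsi ap] := H a; exists (Neg psi);
    [exists psi|move=> /=; apply].
have /choice [F FP] : forall j, exists psi, p psi /\ Neg psi = projT2 l j.
  by move=> j; have [|psi ppsi E] := lp (projT2 l j); [exists j|exists psi].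
exists (existT _ _ F); first by move=> _ [j _ <-]; case: (FP j).
move=> a; have [_ [j _ <-]] := lP a; have [_ <-] := FP j => /= /contrapT ?.
by exists (F j) => //; exists j.
Qed.

(** Saturation over [M] together with [a]: the conditions on [b] are finitely consistent because
    finitely many instances form a single [Phi]. This is the converse of [im_nset]. *)
Lemma nset_limit A a : sat Ms (gdom G) a ->
  (forall Phi, nset phi (memb Ms) Phi A a) ->
  exists b, dset G (memb Ms) A b /\ E_rel phi b a.
Proof.
move=> Ga aP; apply: contrapT => nb.
pose h := join a (memb Ms).
pose GF : formula L ('I_n + ('I_n + M)) := frename inl (gdom G).
pose AF : formula L ('I_n + ('I_n + M)) := frename (join inl (inr \o inr)) A.
pose PF (e : {i : I & 'I_(k i) -> M}) : formula L ('I_n + ('I_n + M)) :=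
  frename (join (join inl (inr \o inl)) (inr \o inr \o tagged e)) (phi (tag e)).
have AFP b : sat Ms AF (join b h) <-> sat Ms A (join b (memb Ms)).
  by rewrite sat_rename comp_join.
have PFP e b : sat Ms (PF e) (join b h) <->
    sat Ms (phi (tag e)) (join (join b a) (memb Ms \o tagged e)).
  by rewrite sat_rename !comp_join.
have [|l lp lP] := @monster_compact _ h n
    [set psi | [\/ psi = GF, psi = AF | exists e, psi = PF e]] (memb_card G Ms).
  move=> b; apply: contrapT => nP; apply: nb.
  have H psi : [\/ psi = GF, psi = AF | exists e, psi = PF e] ->
      sat Ms psi (join b h).
    by move=> psiP; apply: contrapT => npsi; apply: nP; exists psi.
  have Gb : sat Ms (gdom G) b.
    by have := H GF; rewrite sat_rename; apply; apply: Or31.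
  exists b; split; first by split=> //; apply/AFP/H; apply: Or32.
  split=> // i z; apply/(PFP (Tagged (fun i => 'I_(k i) -> M) z))/H.
  by apply: Or33; eexists.
have /choice [Phi PhiP] : forall j, exists Phi : fam {i : I & 'I_(k i) -> M},
    forall b, dset G (memb Ms) A b ->
    (forall e, fam_in Phi e -> sat Ms (PF e) (join b h)) ->
    sat Ms (projT2 l j) (join b h).
  move=> j; have [l0 l0P] := fam_nil {i : I & 'I_(k i) -> M}.
  have [|->|->|[e ->]] := lp (projT2 l j); first by exists j.
  - by exists l0 => b [Gb _] _; rewrite sat_rename.
  - by exists l0 => b [_ Ab] _; apply/AFP.
  - by have [l1 l1P] := fam_one e; exists l1 => b _; apply; rewrite l1P.
have [Psi PsiP] := fam_bigcup Phi.
have [_ [b [Ab bP]]] := aP Psi.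
have [_ [j _ <-]] := lP b; apply; apply: PhiP => // e je.
by apply/PFP/bP; rewrite PsiP; exists j.
Qed.

(** Finite satisfiability in [M] holds by elementarity, since the existence of a common solution of
    finitely many formulas is itself a formula over [M]. *)
Lemma type_of a : sat Ms (gdom G) a ->
  exists2 p : group_type (gdom G) M, realizes (Ms := Ms) a p &
    forall psi, gtype p psi <-> sat Ms psi (join a (memb Ms)).
Proof.
move=> Ga; pose tp := [set psi : formula L ('I_n + M) |
  sat Ms psi (join a (memb Ms))].
have tp_sat : finitely_satisfiable id tp.
  move=> r F tF.
  have dF := definable_exists_tuple
    (definable_forall_fin (fun j => definable_sat (F j))).
  by apply/(definable_memb _ dF); exists a.
have tp_complete psi : tp psi \/ tp (Neg psi) by exact: lem.
have tp_group : tp (frename inl (gdom G)) by apply/sat_rename.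
by exists (GroupType tp_sat tp_complete tp_group).
Qed.

(** Every type over [M] is realised, and [hyper_proj] sends it to the point represented by any
    realisation; so the quotient topology can be tested on representatives. *)
Lemma open_rep (U : set X) : open U <->
  forall a P, rep a P -> U P ->
    exists2 psi, dset G (memb Ms) psi a & im psi `<=` U.
Proof.
have pr p a P : realizes (Ms := Ms) a p -> rep a P -> hyper_proj phi Ms p = P.
  by move=> ap [Ga ->]; exact: hyper_proj_realizes.
split=> [oU a P aP UP|H].
  have [p ap pE] := type_of (rep_group aP).
  have [|psi apsi psiU] := oU p; first by rewrite /preimage/= (pr _ _ _ ap aP).
  exists psi; first by split; [exact: rep_group aP|exact/pE].
  move=> Q [b [[Gb bpsi] bQ]]; have [q bq qpsi] := type_of Gb.
  by rewrite -(pr _ _ _ bq bQ); apply/psiU/qpsi.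
move=> p Up; have [a ap] := realized Ms p.
have [P aP] := group_rep (realizes_group ap).
have [|psi [_ apsi] psiU] := H a P aP.
  by move: Up; rewrite /preimage/= (pr _ _ _ ap aP).
exists psi.
  by have [|/ap /(_ apsi)] := gtype_complete p psi.
move=> q qpsi; have [b bq] := realized Ms q.
have [Q bQ] := group_rep (realizes_group bq).
rewrite /preimage/= (pr _ _ _ bq bQ); apply: (dset_rep psiU _ bQ).
by split; [exact: realizes_group bq|exact: bq].
Qed.

(** By [nset_limit], a representative of a point outside [im A] avoids some [Phi[A]]; by [im_nset],
    no point of [im A] has a representative outside [Phi[A]]. *)
Lemma open_setC_im A : open (~` im A).
Proof.
apply/open_rep => a P aP nAP.
have [Phi nPhi] : exists Phi, ~ nset phi (memb Ms) Phi A a.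
  apply/existsNP => H; apply: nAP.
  have [b [Ab ba]] := nset_limit (rep_group aP) H.
  have [Q bQ] := group_rep (proj1 Ab).
  by exists b; split=> //; rewrite (rep_unique aP (rep_E ba bQ)).
have [F FP] := nset_formula phi Phi A.
exists (Neg F); first by split; [exact: rep_group aP|move=> /= /FP].
move=> Q [b [[Gb nF] bQ]] AQ; apply: nF; apply/FP; exact: im_nset bQ AQ.
Qed.

(** A compactness argument: each [a] either represents a point of [U], and has a neighbourhood
    mapped into [U], or lies outside some [Phi[A]]. The union of the finitely many [Phi] from a
    finite subcover works everywhere. *)
Lemma im_sub_open A U : open U -> im A `<=` U ->
  exists Phi, forall a P, nset phi (memb Ms) Phi A a -> rep a P -> U P.
Proof.
move=> oU AU.
have [|l lp lP] := @monster_cover [set psi | exists Phi, forall a P,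
    nset phi (memb Ms) Phi A a -> sat Ms psi (join a (memb Ms)) ->
    rep a P -> U P].
  move=> a; have [Ga|nGa] := pselect (sat Ms (gdom G) a); last first.
    exists (Neg (frename inl (gdom G))); last by rewrite /= sat_rename.
    have [l0 _] := fam_nil {i : I & 'I_(k i) -> M}; exists l0 => b P _.
    by rewrite /= sat_rename => nGb /rep_group.
  have [P aP] := group_rep Ga.
  have [UP|nUP] := pselect (U P).
    have [psi [_ apsi] psiU] := (open_rep U).1 oU a P aP UP.
    exists psi => //.
    have [l0 _] := fam_nil {i : I & 'I_(k i) -> M}; exists l0 => b Q _ bpsi bQ.
    by apply: (dset_rep psiU _ bQ); split=> //; exact: rep_group bQ.
  have [Phi nPhi] : exists Phi, ~ nset phi (memb Ms) Phi A a.
    apply/existsNP => H; apply/nUP/AU.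
    have [b [Ab ba]] := nset_limit Ga H.
    have [Q bQ] := group_rep (proj1 Ab).
    by exists b; split=> //; rewrite (rep_unique aP (rep_E ba bQ)).
  have [F FP] := nset_formula phi Phi A.
  exists (Neg F); last by move=> /= /FP.
  by exists Phi => b Q bPhi nF; exfalso; apply/nF/FP.
have /choice [Phi PhiP] : forall j, exists Phi, forall a P,
    nset phi (memb Ms) Phi A a -> sat Ms (projT2 l j) (join a (memb Ms)) ->
    rep a P -> U P by move=> j; apply: lp; exists j.
have [Psi PsiP] := fam_bigcup Phi; exists Psi => a P [Ga [b [Ab ba]]] aP.
have [_ [j _ <-] ja] := lP a; apply: (PhiP j a P _ ja aP).
split=> //; exists b; split=> // e je; apply: ba.
by rewrite PsiP; exists j.
Qed.

(** Compactness cuts [A] into finitely many definable pieces, each with image in one [U i]; this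
    gives the countable subadditivity of [inner]. *)
Lemma im_sub_bigcup A (U : nat -> set X) :
  (forall i, open (U i)) -> im A `<=` \bigcup_i U i ->
  exists K (B : nat -> formula L ('I_n + M)), (forall i, im (B i) `<=` U i) /\
    dset G id A `<=` \bigcup_(i in `I_K) dset G id (B i).
Proof.
move=> oU AU.
have [|l lp lP] := @monster_cover [set psi | exists i,
    im (And A psi) `<=` U i].
  move=> a.
  have [Aa|nAa] := pselect (dset G (memb Ms) A a); last first.
    pose GA : formula L ('I_n + M) := And (frename inl (gdom G)) A.
    (* Off [A] the index is arbitrary: [And A (Neg GA)] has empty image. *)
    exists (Neg GA).
      exists 0%N => P [b [[Gb /sat_and[Ab nGA]] bP]]; exfalso; apply: nGA.
      by apply/sat_and; rewrite sat_rename.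
    by move=> /sat_and; rewrite sat_rename.
  have [P aP] := group_rep (proj1 Aa).
  have [i _ UP] := AU P (ex_intro _ a (conj Aa aP)).
  have [psi [_ apsi] psiU] := (open_rep (U i)).1 (oU i) a P aP UP.
  exists psi => //; exists i => Q [b [[Gb /sat_and[Ab bpsi]] bQ]].
  exact: (dset_rep psiU _ bQ).
have /choice [N NP] : forall j, exists i, im (And A (projT2 l j)) `<=` U i.
  by move=> j; apply: lp; exists j.
(* [B i] is the disjunction of the pieces assigned to [i]; it is inconsistent when [i] is no value
   of [N]. *)
have BP i : exists B : formula L ('I_n + M), forall (S : structure L) w,
    sat S B w <->
    ~ forall j, ~ (N j = i /\ sat S (And A (projT2 l j)) w).
  have [|B BP] := @definable_forall_fin L ('I_n + M)%type _
    (fun j S w => ~ (N j = i /\ sat S (And A (projT2 l j)) w)).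
    move=> j; case: (eqVneq (N j) i) => [->|/eqP Nji].
      apply: definable_ext (definable_not (definable_sat (And A (projT2 l j)))).
      by move=> S w; split=> h h'; apply: h => //; case: h'.
    apply: definable_ext (definable_not (definable_false L ('I_n + M)%type)).
    by move=> S w; split=> [_ []|_ []].
  by exists (Neg B) => S w /=; rewrite -BP.
have /choice [B {}BP] := BP.
exists (\max_j N j).+1, B; split=> [i P [b [[Gb /BP/existsNP[j]]]]|a [Ga Aa]].
  by move=> /contrapT[<- Ab] bP; apply: NP; exists b.
have : dset G (memb Ms) A (memb Ms \o a).
  split; first exact/memb_group.
  by move/(memb_elementary Ms): Aa; rewrite comp_join.
have [_ [j _ <-]] := lP (memb Ms \o a).
move=> ja [_ Aa']; exists (N j); first by rewrite /= ltnS leq_bigmax.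
split=> //; apply/BP => /(_ j); apply; split=> //; apply/sat_and; split=> //.
by apply/(memb_elementary Ms); rewrite comp_join.
Qed.

(** * The action of [G(M)] on the quotient *)

Lemma act_group (g : 'I_n -> M) a : sat M (gdom G) g -> sat Ms (gdom G) a ->
  exists2 c, sat Ms (gdom G) c & act g a c.
Proof.
move=> /memb_group Gg Ga.
by have [c [Gc gac _]] := group_op monster_group Gg Ga; exists c.
Qed.

Lemma act_closed (g : 'I_n -> M) a c : sat M (gdom G) g ->
  sat Ms (gdom G) a -> act g a c -> sat Ms (gdom G) c.
Proof.
move=> /memb_group Gg Ga.
by have [c' [Gc' _ H]] := group_op monster_group Gg Ga => /H ->.
Qed.

Lemma act_aut (s : Ms -> Ms) (g : 'I_n -> M) a c : automorphism_over s ->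
  act g a c -> act g (s \o a) (s \o c).
Proof.
move=> [sA sM] /(sat_aut _ sA); rewrite !comp_join.
by rewrite (_ : s \o (memb Ms \o g) = memb Ms \o g)//;
  apply/funext => j /=; rewrite sM.
Qed.

(** Invariance under [g] gives one inclusion, invariance under its inverse the other. *)
Lemma left_translate_class (g : 'I_n -> M) a c : sat M (gdom G) g ->
  sat Ms (gdom G) a -> act g a c ->
  left_translate g (E_class phi a) = E_class phi c.
Proof.
move=> Gg Ga gac; have Gc := act_closed Gg Ga gac.
have [g' Gg' gg'] := memb_inverse Gg.
apply/seteqP; split=> [x [b ab gbx]|x cx]; first exact: (hinv Gg gac gbx ab).
have [_ Gx _] := cx; have [b Gb g'xb] := act_group Gg' Gx.
exists b; last exact/gg'.
by apply: (hinv Gg' _ g'xb cx); apply/gg'.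
Qed.

Lemma htype_translate (g : 'I_n -> M) a c (P Q : X) : sat M (gdom G) g ->
  rep a Q -> act g a c ->
  (htype P = [set left_translate g C | C in htype Q]) <-> rep c P.
Proof.
move=> Gg aQ gac; have Ga := rep_group aQ; have Gc := act_closed Gg Ga gac.
suff -> : [set left_translate g C | C in htype Q] =
    aut_orbit (E_class phi c).
  by split=> [/(htype_rep Gc)//|/rep_htype].
have E (s : Ms -> Ms) : automorphism_over s ->
    left_translate g [set s \o b | b in E_class phi a] =
    [set s \o b | b in E_class phi c].
  move=> sA; rewrite -!E_class_aut//.
  apply: left_translate_class => //; last exact: act_aut.
  exact/(sat_aut _ (proj1 sA)).
rewrite (rep_htype aQ); apply/seteqP; split.
  by move=> _ [_ [s sA ->] <-]; exists s => //; rewrite E.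
by move=> _ [s sA ->]; rewrite -E//; eexists; [exists s|].
Qed.

Lemma translateP (g : 'I_n -> M) a c (P Q : X) (B : set X) :
  sat M (gdom G) g -> rep a Q -> rep c P -> act g a c ->
  translate g B P <-> B Q.
Proof.
move=> Gg aQ cP gac; split=> [[Q' BQ'] |BQ]; last first.
  by exists Q => //; apply/(htype_translate _ Gg aQ gac).
have [a' a'Q'] := rep_ex Q'.
have [c' Gc' gac'] := act_group Gg (rep_group a'Q').
move=> /(htype_translate _ Gg a'Q' gac') c'P.
have [s sA cc'] := rep_conj cP c'P.
have [g' Gg' gg'] := memb_inverse Gg.
suff aa' : E_rel phi (s \o a) a'.
  by rewrite -(rep_unique (rep_E aa' (rep_aut sA aQ)) a'Q') in BQ'.
apply: (hinv Gg' _ _ cc'); last first.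
  by apply/gg' => //; exact: rep_group a'Q'.
have saQ := rep_aut sA aQ; have scP := rep_aut sA cP.
apply/gg'; [exact: rep_group saQ|exact: rep_group scP|exact: act_aut].
Qed.

Lemma translate_ex (g : 'I_n -> M) c (P : X) : sat M (gdom G) g -> rep c P ->
  exists a Q, rep a Q /\ act g a c.
Proof.
move=> Gg cP; have [g' Gg' gg'] := memb_inverse Gg.
have [a Ga g'ca] := act_group Gg' (rep_group cP).
have [Q aQ] := group_rep Ga; exists a, Q; split=> //.
by apply/gg' => //; exact: rep_group cP.
Qed.

Lemma translate_im (g : 'I_n -> M) A F : sat M (gdom G) g ->
  (forall y, sat Ms F (join y (memb Ms)) <-> tset G (memb Ms) g A y) ->
  translate g (im A) = im F.
Proof.
move=> Gg FP; apply/seteqP; split=> P.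
  move=> [Q [a [Aa aQ]]]; have [c Gc gac] := act_group Gg (proj1 Aa).
  move=> /(htype_translate _ Gg aQ gac) cP; exists c; split=> //.
  split=> //; apply/FP; split; first exact/memb_group.
  by exists a.
move=> [c [[Gc /FP [_ [a [Aa gac]]]] cP]].
have [Q aQ] := group_rep (proj1 Aa).
by apply/(translateP _ Gg aQ cP gac); exists a.
Qed.

Lemma translate_mono (g : 'I_n -> M) (A B : set X) :
  A `<=` B -> translate g A `<=` translate g B.
Proof. by move=> AB P [Q /AB BQ E]; exists Q. Qed.

Lemma translate_open (g : 'I_n -> M) (U : set X) : sat M (gdom G) g ->
  open U -> open (translate g U).
Proof.
move=> Gg /open_rep oU; apply/open_rep => c P cP gUP.
have [a [Q [aQ gac]]] := translate_ex Gg cP.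
have UQ := (translateP U Gg aQ cP gac).1 gUP.
have [psi apsi psiU] := oU a Q aQ UQ.
have [F FP] := tset_formula g psi.
exists F.
  split; first exact: rep_group cP.
  by apply/FP; split; [exact/memb_group|exists a].
by rewrite -(translate_im Gg (FP _ (memb Ms))); exact: translate_mono.
Qed.

Lemma translate_inverse (g : 'I_n -> M) : sat M (gdom G) g ->
  exists2 g' : 'I_n -> M, sat M (gdom G) g' &
    forall B : set X, translate g' (translate g B) = B.
Proof.
move=> Gg; have [g' Gg' gg'] := memb_inverse Gg; exists g' => // B.
suff H P : translate g' (translate g B) P <-> B P.
  by apply/seteqP; split=> P /H.
have [c cP] := rep_ex P; have [a [Q [aQ g'ac]]] := translate_ex Gg' cP.
have gca : act g c a.
  by apply/gg' => //; [exact: rep_group cP|exact: rep_group aQ].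
by rewrite (translateP _ Gg' aQ cP g'ac) (translateP _ Gg cP aQ gca).
Qed.

End hyper.

(** * From an invariant measure to the inequalities *)

Section selection.
Local Open Scope classical_set_scope.

(** Take the first [s] of the enumeration with [F s x]; preimages are then finite Boolean
    combinations of the [F s]. The default [s0] is for points not covered by the list of the
    induction. *)
Lemma measurable_selection d (X : measurableType d) (S : finType) (s0 : S)
    (F : S -> set X) : (forall s, measurable (F s)) ->
  (forall x, exists s, F s x) ->
  exists f : X -> S, (forall x, F (f x) x) /\
    forall B : set S, measurable (f @^-1` B).
Proof.
move=> mF Fx.
suff [f [fP mf]] : exists f : X -> S,
    (forall x, (exists2 s, s \in enum S & F s x) -> F (f x) x) /\
    forall B : set S, measurable (f @^-1` B).
  exists f; split=> // x; apply: fP; have [s Fs] := Fx x.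
  by exists s => //; rewrite mem_enum.
elim: (enum S) => [|s l [f [fP mf]]].
  exists (fun=> s0); split=> [x [s]|B]; first by rewrite in_nil.
  rewrite preimage_cst; case: ifP => _.
    exact: measurableT.
  exact: measurable0.
exists (fun x => if x \in F s then s else f x); split.
  move=> x [t]; case: ifPn => [/set_mem//|/negP nFs].
  rewrite inE => /predU1P[->|tl Ft]; first by move=> /mem_set.
  by apply: fP; exists t.
move=> B; rewrite (_ : _ @^-1` B =
    (F s `&` [set _ | B s]) `|` (~` F s `&` f @^-1` B)).
  apply: measurableU; apply: measurableI => //; last exact: measurableC.
  have [Bs|nBs] := pselect (B s).
    by rewrite (_ : [set _ | _] = setT)//; apply/seteqP; split.
  by rewrite (_ : [set _ | _] = set0)//; apply/seteqP; split.
apply/seteqP; split=> x /=; case: ifPn => [/set_mem|/negP] Fs.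
- by left.
- by right; split=> // /mem_set.
- by case=> [[]|[]].
- by case=> [[/mem_set]|[]].
Qed.

End selection.

Section measure_conditions.
Context (R : realType).
Context L (T : theory L) (G : definable_group T) d (I : preorderType d).
Context (k : I -> nat).
Local Notation n := (gdim G).
Variable phi : forall i, formula L ('I_n + 'I_n + 'I_(k i)).
Context (M : model T) (Ms : monster M).
Hypotheses (hE : E_equivalence phi Ms) (hinv : E_invariant phi Ms).
Local Open Scope classical_set_scope.
Local Open Scope ring_scope.

Notation X := (hyper_type phi Ms).

Lemma measurable_im (A : formula L ('I_n + M)) :
  measurable ((im A : set X) : set (borel X)).
Proof.
rewrite -(setCK (im A)); apply: measurableC.
apply: sub_gen_smallest; exact: open_setC_im.
Qed.

Lemma mean_preimage (nu : probability (borel X) R) (S : Type) (f : X -> S) :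
  (forall B : set S, measurable (f @^-1` B : set (borel X))) ->
  mean (fun B => fine (nu (f @^-1` B))).
Proof.
move=> mf; split=> [A||A B AB]; first exact: fine_ge0.
  by rewrite preimage_setT probability_setT.
rewrite preimage_setU measureU//; last first.
  by rewrite -preimage_setI AB preimage_set0.
by rewrite fineD//; exact: fin_num_measure.
Qed.

Lemma invariant_conds (nu : probability (borel X) R) :
  invariant_probability nu ->
  forall l : fam (cond G k M), conds_satisfied phi R (fam_in l).
Proof.
move=> nuinv l.
have /choice [FL FLP] := fun c : cond G k M =>
  tset_formula (cond_elt c) (cond_set c).
have /choice [FR FRP] := fun c : cond G k M =>
  nset_formula phi (cond_nbhd c) (cond_set c).
pose J : finType := ('I_(projT1 l) * bool + unit)%type.
pose F (j : J) := match j with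
  | inl (j, b) => if b then FL (projT2 l j) else FR (projT2 l j)
  | inr _ => frename inl (gdom G) end.
(* The image of the piece with sign pattern [s]; it is some [im A], hence closed and Borel. *)
pose Z (s : {ffun J -> bool}) : set (borel X) := [set P | exists a, rep a P /\
  forall j, sat Ms (F j) (join a (memb Ms)) <-> s j].
have mZ s : measurable (Z s).
  have [A AP] := definable_signs F s.
  rewrite (_ : Z s = (im A : set X)); first exact: measurable_im.
  apply/seteqP; split=> P [a].
    by move=> [aP /AP ?]; exists a; split=> //; split=> //; exact: rep_group aP.
  by move=> [[Ga /AP ?] aP]; exists a.
pose pat a : {ffun J -> bool} :=
  [ffun j => `[< sat Ms (F j) (join a (memb Ms)) >]].
have Zex x : exists s, Z s x.
  have [a ax] := rep_ex x; exists (pat a), a; split=> // j.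
  by rewrite ffunE; split=> /asboolP.
have [f [fP mf]] := measurable_selection [ffun=> true] mZ Zex.
(* By elementarity, a pattern realised in the monster is realised in [M]; [h] picks such a tuple,
   with a junk value when [Z s] is empty. *)
have /choice [h hP] : forall s : {ffun J -> bool}, exists b : 'I_n -> M,
    forall x, Z s x -> forall j, sat M (F j) (join b id) <-> s j.
  move=> s; have [[x [a [_ aP]]]|nZ] := pselect (exists x, Z s x).
    have [b bP] := (definable_memb Ms id (definable_pattern F s)).2
      (ex_intro _ a aP).
    by exists b => _ _.
  have [x0] := carrier_inhabited M.
  by exists (fun=> x0) => x Zx; case: nZ; exists x.
have hf x : exists2 a, rep a x & forall j,
    sat M (F j) (join (h (f x)) id) <-> sat Ms (F j) (join a (memb Ms)).
  have [a [ax aP]] := fP x; exists a => // j.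
  by rewrite (hP _ _ (fP x)) aP.
pose m := fun B => fine (nu (f @^-1` (h @^-1` B))).
have mP : mean m := mean_image (mean_preimage nu mf) h.
exists m; split=> //.
  rewrite /m (_ : f @^-1` _ = setT) ?probability_setT//.
  apply/seteqP; split=> // x _ /=; have [a ax ha] := hf x.
  have := (ha (inr tt)).2; rewrite /= !sat_rename; apply; exact: rep_group ax.
move=> c [j _ <-]; set c' := projT2 l j.
have [Gg|nGg] := pselect (sat M (gdom G) (cond_elt c')); last first.
  rewrite (_ : lhs id c' = set0) ?(mean0 mP) ?(mean_ge0 mP)//.
  by apply/seteqP; split=> // y [].
have mf' B : measurable (f @^-1` (h @^-1` B) : set (borel X)) by exact: mf.
apply: fine_le; [exact: fin_num_measure|exact: fin_num_measure|].
(* The chain is [m(gA) <= nu(im gA) = nu(g im A) = nu(im A) <= m(Phi[A])], the last step by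
   [im_nset]. *)
apply: (@le_trans _ _ (nu (im (FL c')))).
  apply: le_measure; rewrite ?inE//; first exact: measurable_im.
  move=> x /= hx; have [a ax ha] := hf x; exists a; split=> //.
  split; first exact: rep_group ax.
  by apply/(ha (inl (j, true)))/FLP.
rewrite -(translate_im hE hinv (A := cond_set c') Gg (fun y => FLP c' Ms _ y)).
rewrite nuinv//; last exact: measurable_im.
apply: le_measure; rewrite ?inE//; first exact: measurable_im.
move=> x xA /=; have [a ax ha] := hf x.
by apply/FRP/(ha (inl (j, false)))/FRP; exact: im_nset ax xA.
Qed.

End measure_conditions.

(** * Borel measures from values on open sets *)

Section outer_of_open.
Local Open Scope classical_set_scope.
Local Open Scope ereal_scope.
Context (R : realType) (X : ptopologicalType) (lam : set X -> \bar R).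

Definition outer_of_open (B : set X) : \bar R :=
  ereal_inf [set lam U | U in [set U | open U /\ B `<=` U]].

Hypotheses (lam0 : lam set0 = 0) (lam_ge0 : forall U, 0 <= lam U)
  (lamT : lam setT = 1)
  (lam_le : forall U V, U `<=` V -> lam U <= lam V)
  (lam_sub : forall U : nat -> set X, (forall i, open (U i)) ->
    lam (\bigcup_i U i) <= \sum_(i <oo) lam (U i))
  (lam_split : forall U V, open U -> open V ->
    lam (V `&` U) + outer_of_open (V `&` ~` U) <= lam V).

Lemma outer_of_open_le U B : open U -> B `<=` U -> outer_of_open B <= lam U.
Proof. by move=> oU BU; apply: ereal_inf_lbound; exists U. Qed.

Lemma outer_of_openE U : open U -> outer_of_open U = lam U.
Proof.
move=> oU; apply/eqP; rewrite eq_le outer_of_open_le//=.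
by apply: le_ereal_inf_tmp => _ [V [_ UV] <-]; exact: lam_le.
Qed.

Lemma outer_of_open0 : outer_of_open set0 = 0.
Proof. by rewrite outer_of_openE//; exact: open0. Qed.

Lemma outer_of_open_ge0 B : 0 <= outer_of_open B.
Proof. by apply: le_ereal_inf_tmp => _ [U _ <-]. Qed.

Lemma outer_of_open_mono : {homo outer_of_open : A B / A `<=` B >-> A <= B}.
Proof.
move=> A B AB; apply: le_ereal_inf_tmp => _ [U [oU BU] <-].
by apply: outer_of_open_le => //; exact: subset_trans BU.
Qed.

Lemma outer_of_open_fin B : outer_of_open B \is a fin_num.
Proof.
rewrite ge0_fin_numE ?outer_of_open_ge0//.
by apply: (@le_lt_trans _ _ 1); rewrite ?ltry// -lamT;
  apply: outer_of_open_le => //; exact: openT.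
Qed.

Lemma outer_of_open_sigma_subadditive : sigma_subadditive outer_of_open.
Proof.
move=> A; apply/lee_addgt0Pr => e e0.
apply: (le_trans _ (epsilon_trick _ _ (ltW e0))); last first.
  by move=> i; exact: outer_of_open_ge0.
have /choice [U UP] : forall i, exists U, [/\ open U, A i `<=` U &
    lam U <= outer_of_open (A i) + (e / (2 ^ i.+1)%:R)%:E].
  move=> i; have en : (0 < e / (2 ^ i.+1)%:R :> R)%R.
    by rewrite divr_gt0// ltr0n expn_gt0.
  have := lb_ereal_inf_adherent en (outer_of_open_fin (A i)).
  by move=> [_ [U [oU AU] <-] /ltW]; exists U.
apply: (@le_trans _ _ (lam (\bigcup_i U i))).
  apply: outer_of_open_le; first by apply: bigcup_open => i _; case: (UP i).
  by apply: subset_bigcup => i _; case: (UP i).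
apply: le_trans (lam_sub _) _; first by move=> i; case: (UP i).
by apply: lee_nneseries => // i _; case: (UP i).
Qed.

HB.instance Definition _ := isOuterMeasure.Build R X outer_of_open
  outer_of_open0 outer_of_open_ge0 outer_of_open_mono
  outer_of_open_sigma_subadditive.

(** Approximating [B] from outside by open sets [V] reduces the criterion to open test sets, where
    it is [lam_split]. *)
Lemma open_caratheodory U : open U -> outer_of_open.-caratheodory U.
Proof.
move=> oU; apply: le_caratheodory_measurable => B.
apply: le_ereal_inf_tmp => _ [V [oV BV] <-].
apply: le_trans (lam_split oU oV); apply: leeD.
  by apply: outer_of_open_le; [exact: openI|exact: setSI].
by apply: outer_of_open_mono; exact: setSI.
Qed.

Lemma borel_caratheodory (B : set (borel X)) :
  measurable B -> outer_of_open.-caratheodory B.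
Proof.
move: B; apply: smallest_sub; last by move=> U; exact: open_caratheodory.
exact: (@sigma_algebra_measurable _ (caratheodory_type outer_of_open)).
Qed.

Definition borel_of_open : set (borel X) -> \bar R := outer_of_open.

Lemma borel_of_open_sigma_additive : semi_sigma_additive borel_of_open.
Proof.
move=> F mF tF mUF.
apply: caratheodory_measure_sigma_additive => //.
- by move=> i; exact: borel_caratheodory.
- exact: borel_caratheodory.
Qed.

Lemma borel_of_openT : borel_of_open setT = 1.
Proof. by rewrite /borel_of_open outer_of_openE//; exact: openT. Qed.

HB.instance Definition _ := isMeasure.Build _ _ _ borel_of_open
  outer_of_open0 outer_of_open_ge0 borel_of_open_sigma_additive.

HB.instance Definition _ := Measure_isProbability.Build _ _ _ borel_of_open
  borel_of_openT.

Lemma borel_extension : exists nu : probability (borel X) R,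
  forall B : set X, nu B = outer_of_open B.
Proof. by exists borel_of_open. Qed.

End outer_of_open.

(** * From the inequalities to an invariant measure *)

Section measure_of_mean.
Context (R : realType).
Context L (T : theory L) (G : definable_group T) d (I : preorderType d).
Context (k : I -> nat).
Local Notation n := (gdim G).
Variable phi : forall i, formula L ('I_n + 'I_n + 'I_(k i)).
Context (M : model T) (Ms : monster M).
Hypotheses (hE : E_equivalence phi Ms) (hinv : E_invariant phi Ms).
Local Open Scope classical_set_scope.
Local Open Scope ereal_scope.

Notation X := (hyper_type phi Ms).

Variable m : set ('I_n -> M) -> R.
Hypotheses (mP : mean m) (mG : m [set a | sat M (gdom G) a] = 1%R)
  (mC : forall c : cond G k M, (m (lhs id c) <= m (rhs phi id c))%R).

Definition inner (U : set X) : \bar R :=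
  ereal_sup [set (m (dset G id A))%:E | A in [set A | im A `<=` U]].

Lemma inner_ge A U : im A `<=` U -> (m (dset G id A))%:E <= inner U.
Proof. by move=> AU; apply: ereal_sup_ubound; exists A. Qed.

Lemma dset_memb A a : dset G id A a -> dset G (memb Ms) A (memb Ms \o a).
Proof.
move=> [Ga Aa]; split; first exact/memb_group.
by move/(memb_elementary Ms): Aa; rewrite comp_join.
Qed.

Lemma dset_im A a : dset G id A a ->
  exists2 P : X, rep (memb Ms \o a) P & im A P.
Proof.
move=> /dset_memb Aa; have [P aP] := group_rep phi (proj1 Aa).
by exists P => //; exists (memb Ms \o a).
Qed.

Lemma inner_ge0 U : 0 <= inner U.
Proof.
(* The empty set, defined by [Bot], always competes in the supremum. *)
apply: le_trans (inner_ge (A := Bot) _); last by move=> P [a [[_ []]]].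
by rewrite lee_fin mean_ge0.
Qed.

Lemma inner_le U V : U `<=` V -> inner U <= inner V.
Proof.
move=> UV; apply: ge_ereal_sup => _ [A AU <-]; apply: inner_ge.
exact: subset_trans UV.
Qed.

Lemma inner0 : inner set0 = 0.
Proof.
apply/eqP; rewrite eq_le inner_ge0 andbT; apply: ge_ereal_sup => _ [A A0 <-].
rewrite (_ : dset G id A = set0) ?mean0//.
by apply/seteqP; split=> // a /dset_im [P _ /A0].
Qed.

Lemma innerT : inner setT = 1.
Proof.
apply/eqP; rewrite eq_le; apply/andP; split.
  by apply: ge_ereal_sup => _ [A _ <-]; rewrite lee_fin mean_le1.
have := @inner_ge (Imp Bot Bot) setT; rewrite -mG => /(_ (@subsetT _ _)).
rewrite (_ : dset G id _ = [set a | sat M (gdom G) a])//.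
by apply/seteqP; split=> a; [case|split].
Qed.

Lemma inner_bigcup (U : nat -> set X) : (forall i, open (U i)) ->
  inner (\bigcup_i U i) <= \sum_(i <oo) inner (U i).
Proof.
move=> oU; apply: ge_ereal_sup => _ [A AU <-].
have [K [B [BU AB]]] := im_sub_bigcup oU AU.
apply: (@le_trans _ _ (\sum_(0 <= i < K) inner (U i))); last first.
  by apply: nneseries_lim_ge => i _ _; exact: inner_ge0.
apply: (@le_trans _ _ (\sum_(i < K) m (dset G id (B i)))%:E).
  rewrite lee_fin.
  exact: (mean_sub_bigcup mP (F := fun i => dset G id (B i))).
rewrite big_mkord -sumEFin; apply: lee_sum => i _; exact: inner_ge.
Qed.

(** Sets with disjoint images are disjoint, so [m] is additive on them. *)
Lemma inner_disjoint A B V : im A `<=` V -> im B `<=` V `\` im A ->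
  (m (dset G id A))%:E + (m (dset G id B))%:E <= inner V.
Proof.
move=> AV BV; rewrite -EFinD -(meanU mP); last first.
  apply/seteqP; split=> // a [Aa Ba].
  have [P aP AP] := dset_im Aa; have [Q aQ BQ] := dset_im Ba.
  by have [_] := BV _ BQ; rewrite -(rep_unique aP aQ).
pose C : formula L ('I_n + M) := Neg (And (Neg A) (Neg B)).
have CP (S : structure L) v : sat S C v <-> sat S A v \/ sat S B v.
  have -> : sat S C v <-> ~ sat S (And (Neg A) (Neg B)) v by [].
  rewrite sat_and; split=> [H|[h|h] [nA nB]]; [|exact: nA|exact: nB].
  have [hA|nA] := pselect (sat S A v); [by left|right].
  by apply: contrapT => nB; apply: H; split.
have -> : dset G id A `|` dset G id B = dset G id C.
  apply/seteqP; split=> a.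
    by move=> [] [Ga Aa]; split=> //; apply/CP; [left|right].
  by move=> [Ga /CP[Aa|Ba]]; [left|right].
apply: inner_ge => P [a [[Ga /CP[Aa|Ba]] aP]]; first by apply: AV; exists a.
by apply: (subset_trans BV); [exact: subDsetl|exists a].
Qed.

(** If [im A] lies in [V] and [U], then [V] minus [im A] is open and contains [V] minus [U], so its
    [inner] value bounds the outer measure there; each [B] with image inside it is handled by
    [inner_disjoint]. *)
Lemma inner_split U V : open U -> open V ->
  inner (V `&` U) + outer_of_open inner (V `&` ~` U) <= inner V.
Proof.
move=> oU oV; set be := outer_of_open _ _.
have fin : be \is a fin_num.
  by apply: outer_of_open_fin; [exact: inner_ge0|exact: innerT].
rewrite -leeBrDr//; apply: ge_ereal_sup => _ [A AVU <-].
rewrite leeBrDr// addeC -leeBrDr//.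
apply: (@le_trans _ _ (inner (V `\` im A))).
  apply: outer_of_open_le; first by apply: openI => //; exact: open_setC_im.
  by move=> P [VP nUP]; split=> // /AVU [].
apply: ge_ereal_sup => _ [B BVA <-]; rewrite leeBrDr// addeC.
by apply: inner_disjoint => // P /AVU [].
Qed.

(** Let [F] define [gA]. By [im_sub_open] some [Phi[F]] still maps into [gU], and the inequality for
    [g'] and [F] gives [m(A) <= m(g'F) <= m(Phi[F])]. *)
Lemma inner_translate (g : 'I_n -> M) U : sat M (gdom G) g -> open U ->
  inner U <= inner (translate g U).
Proof.
move=> Gg oU; apply: ge_ereal_sup => _ [A AU <-].
have [g' Gg' gg'] := group_inverse (dgroupP G M) Gg.
have [F FP] := tset_formula g A.
have FU : im F `<=` translate g U.
  by rewrite -(translate_im hE hinv Gg (FP _ (memb Ms))); exact: translate_mono.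
have [Phi PhiP] := im_sub_open hE (translate_open hE hinv Gg oU) FU.
have [N NP] := nset_formula phi Phi F.
apply: (@le_trans _ _ (m (dset G id N))%:E).
  rewrite lee_fin; apply: (@le_trans _ _ (m (lhs id (Cond g' F Phi)))).
    apply: mean_le => // a [Ga Aa]; split=> //.
    have [c [Gc gac _]] := group_op (dgroupP G M) Gg Ga.
    exists c; split; last exact/gg'.
    by split=> //; apply/FP; split=> //; exists a.
  apply: le_trans (mC _) _; apply: mean_le => // y [Gy Ny].
  by split=> //; apply/NP.
apply: inner_ge => P [a [[_ /NP Na] aP]]; exact: PhiP Na aP.
Qed.

(** For open [U] containing [B], [inner_translate] for the inverse of [g] bounds the value of [gU]
    by that of [U]. *)
Lemma outer_translate_le (g : 'I_n -> M) (B : set X) : sat M (gdom G) g ->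
  outer_of_open inner (translate g B) <= outer_of_open inner B.
Proof.
move=> Gg; apply: le_ereal_inf_tmp => _ [U [oU BU] <-].
have [g' Gg' gK] := translate_inverse hE hinv Gg.
have ogU := translate_open hE hinv Gg oU.
apply: (@le_trans _ _ (inner (translate g U))).
  by apply: outer_of_open_le => //; exact: translate_mono.
by have := inner_translate Gg' ogU; rewrite gK.
Qed.

Lemma mean_invariant : exists nu : probability (borel X) R,
  invariant_probability nu.
Proof.
have [nu nuE] := borel_extension inner0 inner_ge0 innerT inner_le inner_bigcup
  inner_split.
exists nu => g B Gg _; rewrite !nuE; apply/eqP; rewrite eq_le.
rewrite outer_translate_le//=; have [g' Gg' gK] := translate_inverse hE hinv Gg.
by rewrite -{1}(gK B) outer_translate_le.
Qed.

End measure_of_mean.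

Theorem corollary3p32 (R : realType) (L : language) (T : theory L)
  (hT : complete_theory T)
  (G : definable_group T)
  (d : Order.disp_t) (I : preorderType d) (k : I -> nat)
  (phi : forall i : I, formula L ('I_(gdim G) + 'I_(gdim G) + 'I_(k i)))
  (hphi : vee_definable phi)
  (hE : forall (M : model T) (Ms : monster M), E_equivalence phi Ms)
  (hinv : forall (M : model T) (Ms : monster M), E_invariant phi Ms)
  (M N : model T) (Ms : monster M) (Ns : monster N) :
  (exists mu : probability (borel (hyper_type phi Ms)) R,
     invariant_probability mu) <->
  (exists nu : probability (borel (hyper_type phi Ns)) R,
     invariant_probability nu).
Proof.
(* Both models and both monsters are arbitrary, so one implication suffices. *)
have oneway (M1 M2 : model T) (Ms1 : monster M1) (Ms2 : monster M2) :
    (exists mu : probability (borel (hyper_type phi Ms1)) R,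
       invariant_probability mu) ->
    exists nu : probability (borel (hyper_type phi Ms2)) R,
      invariant_probability nu.
  move=> [mu /(invariant_conds (hE M1 Ms1) (hinv M1 Ms1)) C1].
  have [m [mP mG mC]] := mean_limit (conds_transfer (M := M1) (N := M2) hT C1).
  exact: (mean_invariant (hE M2 Ms2) (hinv M2 Ms2) mP mG mC).
by split; exact: oneway.
Qed.
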